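(* Let $R$ be a commutative ring which is either an elementary divisor ring or an almost local-global coherent Prüfer ring. Let $M$ be a finitely presented $R$-module. Then $\mathrm{Aut}_R(M)\times\mathrm{SL}_n(R)$ acts transitively on $V_n(M)$ for every $n\ge\mu(M)$.
   Context: All rings are commutative with identity. For a finitely generated $R$-module $M$, $\mu(M)$ is the minimal number of generators of $M$; for $n\ge\mu(M)$, $V_n(M)\subseteq M^n$ is the set of $n$-tuples whose components generate $M$. The group $\mathrm{SL}_n(R)$ of matrices of determinant $1$ acts on $V_n(M)$ by matrix right-multiplication, and the group $\mathrm{Aut}_R(M)$ of $R$-automorphisms of $M$ acts diagonally on $M^n$ from the left; these actions commute, so $\mathrm{Aut}_R(M)\times\mathrm{SL}_n(R)$ acts on $V_n(M)$. A ring $R$ is an elementary divisor ring if for every $m\times n$ matrix $A$ over $R$ there are $B\in\mathrm{GL}_m(R)$, $C\in\mathrm{GL}_n(R)$ such that $BAC$ is diagonal with diagonal coefficients $d_1,\dots,d_k$ satisfying $d_{i+1}\mid d_i$ for $1\le i\le k-1$. A ring is arithmetic if its finitely generated ideals are locally principal; a Prüfer ring is a reduced arithmetic ring; a ring is coherent if its finitely generated ideals are finitely presented. (A coherent Prüfer ring is the same as a semihereditary ring.) A ring $R$ is local-global (LG) if every (possibly multivariate) polynomial over $R$ whose values generate the ideal $R$ takes a unit as a value. A ring $R$ is almost local-global if $R/Rr$ is local-global for every regular element (non-zero-divisor) $r\in R$. *)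

(* Defs.v *)
From HB Require Import structures.
From mathcomp Require Import all_boot all_algebra boolp.
From mathcomp Require Import mpoly ring.

Set Implicit Arguments.
Unset Strict Implicit.
Unset Printing Implicit Defensive.

Import GRing.Theory.
Local Open Scope ring_scope.
Local Open Scope quotient_scope.

(* Rings are [comPzRingType]s, so that the zero ring is allowed.  Submodules  *)
(* and ideals are Prop-valued predicates; an ideal of R is a submodule of the *)
(* regular module R^o.                                                        *)

Section Modules.
Variables (R : comPzRingType) (M : lmodType R).

Definition span n (v : {ffun 'I_n -> M}) (x : M) : Prop :=
  exists c : {ffun 'I_n -> R}, x = \sum_i c i *: v i.

Definition finitely_generated (N : M -> Prop) : Prop :=
  exists (n : nat) (v : {ffun 'I_n -> M}), forall x, N x <-> span v x.

(* V_n(M) *)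
Definition generating n (v : {ffun 'I_n -> M}) : Prop := forall x, span v x.

(* m = mu(M) *)
Definition is_min_generators (m : nat) : Prop :=
  (exists v : {ffun 'I_m -> M}, generating v) /\
  (forall k, (exists v : {ffun 'I_k -> M}, generating v) -> m <= k)%N.

Definition sl_act n (v : {ffun 'I_n -> M}) (A : 'M[R]_n) : {ffun 'I_n -> M} :=
  [ffun j => \sum_i A i j *: v i].

Definition aut_act n (f : {linear M -> M}) (v : {ffun 'I_n -> M}) :
    {ffun 'I_n -> M} :=
  [ffun j => f (v j)].

Definition aut_sl_transitive n : Prop :=
  forall v w : {ffun 'I_n -> M}, generating v -> generating w ->
  exists (f : {linear M -> M}) (A : 'M[R]_n),
    [/\ bijective f, \det A = 1 & w = aut_act f (sl_act v A)].

End Modules.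

(* The submodule N of M is the image of some R^n under a linear map whose     *)
(* kernel is finitely generated.                                              *)
Definition finitely_presented_sub (R : comPzRingType) (M : lmodType R)
    (N : M -> Prop) : Prop :=
  exists (n : nat) (phi : {linear 'rV[R]_n -> M}),
    (forall x, N x <-> exists u, phi u = x) /\
    finitely_generated (fun u => phi u = 0).

Definition finitely_presented (R : comPzRingType) (M : lmodType R) : Prop :=
  @finitely_presented_sub R M (fun _ => True).

Section ElementaryDivisorRing.
Variable R : comPzRingType.

(* [unitmx] is only available over rings with a decidable unit predicate. *)
Definition invertible_mx n (B : 'M[R]_n) : Prop :=
  exists B' : 'M[R]_n, B *m B' = 1%:M /\ B' *m B = 1%:M.

Definition elementary_divisor_ring : Prop :=
  forall (m n : nat) (A : 'M[R]_(m, n)),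
  exists (B : 'M[R]_m) (C : 'M[R]_n),
    [/\ invertible_mx B, invertible_mx C,
        forall (i : 'I_m) (j : 'I_n), (i : nat) <> j -> (B *m A *m C) i j = 0
      & forall (i i' : 'I_m) (j j' : 'I_n),
          (i : nat) = j -> (i' : nat) = i.+1 -> (j' : nat) = j.+1 ->
          exists c : R, (B *m A *m C) i j = c * (B *m A *m C) i' j'].

End ElementaryDivisorRing.

(* The ring of fractions S^-1 R. *)
Section Localization.
Variables (R : comPzRingType) (S : mulrClosed R).

Local Notation frac_pair := (R * {s : R | s \in S})%type.

Implicit Types x y z : frac_pair.

Definition frac_equiv x y : bool :=
  `[< exists2 u, u \in S & u * (x.1 * sval y.2) = u * (y.1 * sval x.2) >].

Lemma frac_equivP x y :
  reflect (exists2 u, u \in S & u * (x.1 * sval y.2) = u * (y.1 * sval x.2))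
          (frac_equiv x y).
Proof. exact: asboolP. Qed.

Lemma frac_equiv_refl : reflexive frac_equiv.
Proof. by move=> x; apply/frac_equivP; exists 1; rewrite ?rpred1. Qed.

Lemma frac_equiv_sym : ssrbool.symmetric frac_equiv.
Proof.
by move=> x y; apply/frac_equivP/frac_equivP => -[u uS e]; exists u.
Qed.

Lemma frac_equiv_trans : transitive frac_equiv.
Proof.
move=> y x z /frac_equivP[u uS e1] /frac_equivP[v vS e2]; apply/frac_equivP.
exists (u * v * sval y.2); first by rewrite !rpredM // (valP y.2).
transitivity (v * sval z.2 * (u * (x.1 * sval y.2))).
  by rewrite -!mulrA; ring.
rewrite e1; transitivity (u * sval x.2 * (v * (y.1 * sval z.2))); first by ring.
by rewrite e2; ring.
Qed.

Canonical frac_equiv_rel :=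
  EquivRel frac_equiv frac_equiv_refl frac_equiv_sym frac_equiv_trans.

Definition localization : Type := {eq_quot frac_equiv}.
HB.instance Definition _ : EqQuotient _ frac_equiv localization :=
  EqQuotient.on localization.
HB.instance Definition _ := Choice.on localization.

Fact mulr_closed_den (s t : {s : R | s \in S}) : sval s * sval t \in S.
Proof. by rewrite rpredM ?(valP s) ?(valP t). Qed.

Definition denM (s t : {s : R | s \in S}) : {s : R | s \in S} :=
  exist _ (sval s * sval t) (mulr_closed_den s t).
Definition den1 : {s : R | s \in S} := exist _ 1 (rpred1 S).

Definition fracD x y : frac_pair :=
  (x.1 * sval y.2 + y.1 * sval x.2, denM x.2 y.2).
Definition fracM x y : frac_pair := (x.1 * y.1, denM x.2 y.2).
Definition fracN x : frac_pair := (- x.1, x.2).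

Definition loc_add : localization -> localization -> localization :=
  lift_op2 localization fracD.
Definition loc_mul : localization -> localization -> localization :=
  lift_op2 localization fracM.
Definition loc_opp : localization -> localization :=
  lift_op1 localization fracN.
Definition loc_frac (a : R) (s : {s : R | s \in S}) : localization :=
  \pi_localization (a, s).

Lemma eq_frac (x y : frac_pair) u :
  u \in S -> u * (x.1 * sval y.2) = u * (y.1 * sval x.2) ->
  \pi_localization x = \pi_localization y.
Proof. by move=> uS e; apply/eqmodP/frac_equivP; exists u. Qed.

Lemma frac_eqP (x y : frac_pair) :
  \pi_localization x = \pi_localization y ->
  exists2 u, u \in S & u * (x.1 * sval y.2) = u * (y.1 * sval x.2).
Proof. by move=> /eqmodP/frac_equivP. Qed.

Lemma pi_loc_add : {morph \pi_localization : x y / fracD x y >-> loc_add x y}.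
Proof.
move=> x y; rewrite /loc_add; unlock.
have /frac_eqP[u uS e1] := reprK (\pi_localization x).
have /frac_eqP[v vS e2] := reprK (\pi_localization y).
move: (repr _) e1 => x' e1; move: (repr _) e2 => y' e2.
apply: (@eq_frac _ _ (u * v)); first exact: rpredM.
case: x y x' y' => [a s] [b t] [a' s'] [b' t'] /= in e1 e2 *.
transitivity (v * sval t * sval t' * (u * (a * sval s')) +
              u * sval s * sval s' * (v * (b * sval t'))); first by ring.
by rewrite -e1 -e2; ring.
Qed.

Lemma pi_loc_mul : {morph \pi_localization : x y / fracM x y >-> loc_mul x y}.
Proof.
move=> x y; rewrite /loc_mul; unlock.
have /frac_eqP[u uS e1] := reprK (\pi_localization x).
have /frac_eqP[v vS e2] := reprK (\pi_localization y).
move: (repr _) e1 => x' e1; move: (repr _) e2 => y' e2.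
apply: (@eq_frac _ _ (u * v)); first exact: rpredM.
case: x y x' y' => [a s] [b t] [a' s'] [b' t'] /= in e1 e2 *.
transitivity ((u * (a * sval s')) * (v * (b * sval t'))); first by ring.
by rewrite -e1 -e2; ring.
Qed.

Lemma pi_loc_opp : {morph \pi_localization : x / fracN x >-> loc_opp x}.
Proof.
move=> x; rewrite /loc_opp; unlock.
have /frac_eqP[u uS e1] := reprK (\pi_localization x).
move: (repr _) e1 => x' e1; apply: (@eq_frac _ _ u) => //=.
by rewrite mulNr mulrN -e1; ring.
Qed.

Lemma loc_addA : associative loc_add.
Proof.
elim/quotW=> -[a s]; elim/quotW=> -[b t]; elim/quotW=> -[c w].
rewrite -!pi_loc_add; apply: (@eq_frac _ _ 1); rewrite ?rpred1 //=; ring.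
Qed.

Lemma loc_addC : commutative loc_add.
Proof.
elim/quotW=> -[a s]; elim/quotW=> -[b t].
rewrite -!pi_loc_add; apply: (@eq_frac _ _ 1); rewrite ?rpred1 //=; ring.
Qed.

Lemma loc_add0 : left_id (loc_frac 0 den1) loc_add.
Proof.
elim/quotW=> -[a s].
rewrite -!pi_loc_add; apply: (@eq_frac _ _ 1); rewrite ?rpred1 //=; ring.
Qed.

Lemma loc_addN : left_inverse (loc_frac 0 den1) loc_opp loc_add.
Proof.
elim/quotW=> -[a s].
rewrite -pi_loc_opp -!pi_loc_add.
apply: (@eq_frac _ _ 1); rewrite ?rpred1 //=; ring.
Qed.

HB.instance Definition _ :=
  GRing.isZmodule.Build localization loc_addA loc_addC loc_add0 loc_addN.

Lemma loc_mulA : associative loc_mul.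
Proof.
elim/quotW=> -[a s]; elim/quotW=> -[b t]; elim/quotW=> -[c w].
rewrite -!pi_loc_mul; apply: (@eq_frac _ _ 1); rewrite ?rpred1 //=; ring.
Qed.

Lemma loc_mulC : commutative loc_mul.
Proof.
elim/quotW=> -[a s]; elim/quotW=> -[b t].
rewrite -!pi_loc_mul; apply: (@eq_frac _ _ 1); rewrite ?rpred1 //=; ring.
Qed.

Lemma loc_mul1 : left_id (loc_frac 1 den1) loc_mul.
Proof.
elim/quotW=> -[a s].
rewrite -!pi_loc_mul; apply: (@eq_frac _ _ 1); rewrite ?rpred1 //=; ring.
Qed.

Lemma loc_mulD : left_distributive loc_mul loc_add.
Proof.
elim/quotW=> -[a s]; elim/quotW=> -[b t]; elim/quotW=> -[c w].
rewrite -!pi_loc_mul -!pi_loc_add -!pi_loc_mul.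
apply: (@eq_frac _ _ 1); rewrite ?rpred1 //=; ring.
Qed.

HB.instance Definition _ :=
  GRing.Zmodule_isComPzRing.Build localization
    loc_mulA loc_mulC loc_mul1 loc_mulD.

End Localization.

Record prime_ideal (R : comPzRingType) := PrimeIdeal {
  prime_mem : {pred R};
  prime_ideal0 : 0 \in prime_mem;
  prime_idealD : forall x y,
    x \in prime_mem -> y \in prime_mem -> x + y \in prime_mem;
  prime_idealM : forall a x, x \in prime_mem -> a * x \in prime_mem;
  prime_ideal1 : 1 \notin prime_mem;
  prime_idealP : forall x y,
    x * y \in prime_mem -> x \in prime_mem \/ y \in prime_mem }.

Definition prime_compl (R : comPzRingType) (P : prime_ideal R) : R -> bool :=
  fun x => x \notin prime_mem P.

Lemma prime_compl_closed (R : comPzRingType) (P : prime_ideal R) :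
  mulr_closed (prime_compl P).
Proof.
split=> [|x y]; first exact: prime_ideal1.
by rewrite !unfold_in => xP yP; apply/negP => /prime_idealP[]; apply/negP.
Qed.

HB.instance Definition _ (R : comPzRingType) (P : prime_ideal R) :=
  GRing.isMulClosed.Build R (prime_compl P) (prime_compl_closed P).

Definition localization_at (R : comPzRingType) (P : prime_ideal R) :=
  localization (GRing.MulClosed.clone R (prime_compl P) _).

Section PruferCoherent.
Variable R : comPzRingType.

(* The ideal S^-1 I of S^-1 R. *)
Definition extended_ideal (S : mulrClosed R) (I : R -> Prop)
    (x : localization S) : Prop :=
  exists (a : R) (s : {s : R | s \in S}), I a /\ x = loc_frac a s.

Definition arithmetic : Prop :=
  forall I : R^o -> Prop, finitely_generated I ->
  forall P : prime_ideal R,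
  exists g : localization_at P,
  forall x : localization_at P,
    extended_ideal I x <-> exists c : localization_at P, x = c * g.

Definition reduced : Prop := forall (x : R) (n : nat), x ^+ n = 0 -> x = 0.

Definition prufer : Prop := reduced /\ arithmetic.

Definition coherent : Prop :=
  forall I : R^o -> Prop,
    finitely_generated I -> @finitely_presented_sub R R^o I.

End PruferCoherent.

(* The hypothesis on [p] says that the ideal generated by the values of [p]    *)
(* contains 1.                                                                *)
Definition local_global (T : comNzRingType) : Prop :=
  forall (n : nat) (p : {mpoly T[n]}),
    (exists (k : nat) (c : 'I_k -> T) (x : 'I_k -> 'I_n -> T),
       \sum_j c j * p.@[x j] = 1) ->
    exists (x : 'I_n -> T) (y : T), p.@[x] * y = 1.

(* R/Rr is given, up to isomorphism, as a surjective morphism with kernel Rr. *)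
(* [{mpoly T[n]}] needs a nonzero ring T, hence so does [local_global]; this  *)
(* only leaves out the case of a unit r, where R/Rr is the zero ring, which   *)
(* is local-global because all its elements are units.                        *)
Definition almost_local_global (R : comPzRingType) : Prop :=
  forall r : R, GRing.lreg r ->
  forall (T : comNzRingType) (pi : {rmorphism R -> T}),
    (forall y, exists x, pi x = y) ->
    (forall x, pi x = 0 <-> exists a, x = a * r) ->
    local_global T.

(* Main.v *)
(* Two generating n-tuples of M are two surjections R^n -> M, with finitely     *)
(* generated kernels K and L such that R^n/K and R^n/L are isomorphic, and one  *)
(* has to find a matrix of determinant 1 that maps K onto L.                    *)
(*   Over an elementary divisor ring, K and L are diagonal up to GL_n, and the   *)
(* ideals on the diagonal only depend on M.                                     *)
(*   In the other case, argue by induction on n.  Annihilators of elements are   *)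
(* generated by idempotents, which allows one to assume that K has constant     *)
(* rank.  The content I of K is an invertible ideal that only depends on M.     *)
(* - If K has rank at least 2, then applying twice the local-global property    *)
(*   of R/Rs, for regular elements s, yields a unimodular vector in (K : I),     *)
(*   that some matrix of SL_n maps to e_1.  Then K = I e_1 + K_1 with K_1 in     *)
(*   R^(n-1), similarly L = I e_1 + L_1, and the summand R/I of M cancels by     *)
(*   Evans' theorem since R/I has stable range 1.                               *)
(* - If K has rank 1, then (K : I) and (L : I) are rank one direct summands of   *)
(*   R^n with isomorphic complements.  They are isomorphic themselves, by the    *)
(*   adjugate of an isomorphism between the complements.                         *)

From HB Require Import structures.
Require Import Defs.
From mathcomp Require Import all_boot all_algebra boolp ring mpoly.
From mathcomp Require Import perm ring_quotient.
From mathcomp Require classical_sets.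

Set Implicit Arguments.
Unset Strict Implicit.
Unset Printing Implicit Defensive.

Import GRing.Theory.
Local Open Scope ring_scope.
Local Open Scope quotient_scope.

(** * Row spaces *)

(** Generating n-tuples of M are surjections R^n -> M whose kernels are row spaces of matrices K and
    L with isomorphic quotients ([miso]). By [sl_cancel_transitive] it suffices that such kernels
    are exchanged by a matrix of determinant 1 ([sl_cancel_ring]).

    Over an elementary divisor ring, K and L become diagonal with divisibility chains, whose ideals
    are invariants of the quotient ([divisor_chain_miso]); [edr_sl_cancel] then repairs the
    determinant by a unit diagonal matrix.

    In the other case R is reduced, annihilators of elements are generated by idempotents
    ([principal_annihilator]), ideals (a, b) are locally principal in equational form
    ([arithmetic_comaximal]), and R/Rs has stable range one for regular s
    ([almost_local_global_stable]). [prufer_sl_cancel] is an induction on n. An idempotent separates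
    the part where K has rank at most 1 from the part where its 2x2 minors have zero annihilator,
    and [sl_equiv_mix] glues. On the second part, K splits as I e_1 + K_1 up to SL_n
    ([split_unimodular]) with I its content, an invariant by [content_miso]; so does L, and R/I
    cancels ([miso_cancel]). On the first part ([rank1_sl_equiv]), K and L lie in rank one summands
    of R^n with isomorphic complements; the adjugate of that isomorphism matches the summands
    themselves. *)

Section RowSpaces.
Variable R : comPzRingType.

(* Finitely generated submodules of R^n are represented as row spaces, and     *)
(* [rle] is their inclusion.                                                   *)
Definition rle m p n (A : 'M[R]_(m, n)) (B : 'M[R]_(p, n)) : Prop :=
  exists X : 'M[R]_(m, p), A = X *m B.

Lemma rle_refl m n (A : 'M[R]_(m, n)) : rle A A.
Proof. by exists 1%:M; rewrite mul1mx. Qed.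

Lemma rle_mul m p n (X : 'M[R]_(m, p)) (B : 'M[R]_(p, n)) : rle (X *m B) B.
Proof. by exists X. Qed.

Lemma rle_trans m p q n (B : 'M[R]_(p, n)) (A : 'M[R]_(m, n))
  (C : 'M[R]_(q, n)) : rle A B -> rle B C -> rle A C.
Proof. by move=> [X ->] [Y ->]; exists (X *m Y); rewrite mulmxA. Qed.

Lemma rle_mull m p q n (X : 'M[R]_(q, m)) (A : 'M[R]_(m, n))
  (B : 'M[R]_(p, n)) : rle A B -> rle (X *m A) B.
Proof. by move=> [Y ->]; rewrite mulmxA; apply: rle_mul. Qed.

Lemma rle_mulr m p n q (A : 'M[R]_(m, n)) (B : 'M[R]_(p, n))
  (X : 'M[R]_(n, q)) : rle A B -> rle (A *m X) (B *m X).
Proof. by move=> [Y ->]; exists Y; rewrite mulmxA. Qed.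

Lemma rle0 m p n (B : 'M[R]_(p, n)) : rle (0 : 'M[R]_(m, n)) B.
Proof. by exists 0; rewrite mul0mx. Qed.

Lemma rleD m p n (A A' : 'M[R]_(m, n)) (B : 'M[R]_(p, n)) :
  rle A B -> rle A' B -> rle (A + A') B.
Proof. by move=> [X ->] [Y ->]; exists (X + Y); rewrite mulmxDl. Qed.

Lemma rleN m p n (A : 'M[R]_(m, n)) (B : 'M[R]_(p, n)) :
  rle A B -> rle (- A) B.
Proof. by move=> [X ->]; exists (- X); rewrite mulNmx. Qed.

Lemma rleB m p n (A A' : 'M[R]_(m, n)) (B : 'M[R]_(p, n)) :
  rle A B -> rle A' B -> rle (A - A') B.
Proof. by move=> hA /rleN; apply: rleD. Qed.

Lemma rleZ m p n a (A : 'M[R]_(m, n)) (B : 'M[R]_(p, n)) :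
  rle A B -> rle (a *: A) B.
Proof. by move=> [X ->]; exists (a *: X); rewrite scalemxAl. Qed.

Lemma rle_sum m p n (I : Type) (r : seq I) (F : I -> 'M[R]_(m, n))
  (B : 'M[R]_(p, n)) : (forall i, rle (F i) B) -> rle (\sum_(i <- r) F i) B.
Proof.
move=> h; elim/big_rec: _ => [|i x _ hx]; first exact: rle0.
exact: rleD.
Qed.

Lemma rle_col m1 m2 p n (A1 : 'M[R]_(m1, n)) (A2 : 'M[R]_(m2, n))
  (B : 'M[R]_(p, n)) : rle A1 B -> rle A2 B -> rle (col_mx A1 A2) B.
Proof. by move=> [X ->] [Y ->]; exists (col_mx X Y); rewrite mul_col_mx. Qed.

Lemma rle_usub m p1 p2 n (A : 'M[R]_(m, n)) (B1 : 'M[R]_(p1, n))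
  (B2 : 'M[R]_(p2, n)) : rle A B1 -> rle A (col_mx B1 B2).
Proof.
by move=> [X ->]; exists (row_mx X 0); rewrite mul_row_col mul0mx addr0.
Qed.

Lemma rle_dsub m p1 p2 n (A : 'M[R]_(m, n)) (B1 : 'M[R]_(p1, n))
  (B2 : 'M[R]_(p2, n)) : rle A B2 -> rle A (col_mx B1 B2).
Proof.
by move=> [X ->]; exists (row_mx 0 X); rewrite mul_row_col mul0mx add0r.
Qed.

Lemma rle_rows m p n (A : 'M[R]_(m, n)) (B : 'M[R]_(p, n)) :
  (forall i, rle (row i A) B) -> rle A B.
Proof.
move=> /(@fin_all_exists _ (fun=> 'rV_p)) [X h].
exists (\matrix_i X i); apply/row_matrixP => i.
by rewrite row_mul rowK -h.
Qed.

(* R^n/K and R^n/L are isomorphic: G and H lift an isomorphism and its inverse. *)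
Definition miso m p n (K : 'M[R]_(m, n)) (L : 'M[R]_(p, n)) : Prop :=
  exists G H : 'M[R]_n,
    [/\ rle (K *m G) L, rle (L *m H) K, rle (G *m H - 1%:M) K
      & rle (H *m G - 1%:M) L].

Definition sl_equiv m p n (K : 'M[R]_(m, n)) (L : 'M[R]_(p, n)) : Prop :=
  exists A : 'M[R]_n, [/\ \det A = 1, rle (K *m A) L & rle L (K *m A)].

Definition same_rows m p n (K : 'M[R]_(m, n)) (L : 'M[R]_(p, n)) : Prop :=
  rle K L /\ rle L K.

Lemma miso_sym m p n (K : 'M[R]_(m, n)) (L : 'M[R]_(p, n)) :
  miso K L -> miso L K.
Proof. by move=> [G [H [? ? ? ?]]]; exists H, G. Qed.

Lemma miso_trans m p q n (L : 'M[R]_(p, n)) (K : 'M[R]_(m, n))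
  (N : 'M[R]_(q, n)) : miso K L -> miso L N -> miso K N.
Proof.
move=> [G [H [h1 h2 h3 h4]]] [G' [H' [k1 k2 k3 k4]]].
exists (G *m G'), (H' *m H); split.
- by rewrite mulmxA; apply: rle_trans k1; apply: rle_mulr.
- by rewrite mulmxA; apply: rle_trans h2; apply: rle_mulr.
- have -> : G *m G' *m (H' *m H) - 1%:M =
     G *m ((G' *m H' - 1%:M) *m H) + (G *m H - 1%:M).
    by rewrite mulmxBl mul1mx mulmxBr !mulmxA addrA subrK.
  by apply: rleD => //; apply: rle_mull; apply: rle_trans h2; apply: rle_mulr.
- have -> : H' *m H *m (G *m G') - 1%:M =
     H' *m ((H *m G - 1%:M) *m G') + (H' *m G' - 1%:M).
    by rewrite mulmxBl mul1mx mulmxBr !mulmxA addrA subrK.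
  by apply: rleD => //; apply: rle_mull; apply: rle_trans k1; apply: rle_mulr.
Qed.

Lemma miso_mulr m p n (K : 'M[R]_(m, n)) (L : 'M[R]_(p, n)) (A A' : 'M[R]_n) :
  A *m A' = 1%:M -> A' *m A = 1%:M -> same_rows (K *m A) L -> miso K L.
Proof.
move=> AA' A'A [h1 h2]; exists A, A'; split=> //.
- by apply: rle_trans (rle_mulr A' h2) _; rewrite -mulmxA AA' mulmx1;
    apply: rle_refl.
- by rewrite AA' subrr; apply: rle0.
- by rewrite A'A subrr; apply: rle0.
Qed.

Lemma det1_inv n (A : 'M[R]_n) : \det A = 1 ->
  A *m \adj A = 1%:M /\ \adj A *m A = 1%:M.
Proof. by move=> dA; rewrite mul_mx_adj mul_adj_mx dA. Qed.

Lemma sl_equiv_miso m p n (K : 'M[R]_(m, n)) (L : 'M[R]_(p, n)) :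
  sl_equiv K L -> miso K L.
Proof. by move=> [A [/det1_inv[h1 h2] ? ?]]; apply: (miso_mulr h1 h2). Qed.

Lemma sl_equiv_sym m p n (K : 'M[R]_(m, n)) (L : 'M[R]_(p, n)) :
  sl_equiv K L -> sl_equiv L K.
Proof.
move=> [A [dA h1 h2]]; have [AA' A'A] := det1_inv dA.
exists (\adj A); split.
- by have := congr1 determinant AA'; rewrite det_mulmx dA mul1r det1.
- by apply: rle_trans (rle_mulr _ h2) _; rewrite -mulmxA AA' mulmx1;
    apply: rle_refl.
- by apply: rle_trans (rle_mulr _ h1); rewrite -mulmxA AA' mulmx1;
    apply: rle_refl.
Qed.

Lemma sl_equiv_trans m p q n (L : 'M[R]_(p, n)) (K : 'M[R]_(m, n))
  (N : 'M[R]_(q, n)) : sl_equiv K L -> sl_equiv L N -> sl_equiv K N.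
Proof.
move=> [A [dA h1 h2]] [B [dB k1 k2]]; exists (A *m B); split.
- by rewrite det_mulmx dA dB mulr1.
- by rewrite mulmxA; apply: rle_trans (rle_mulr _ h1) k1.
- by rewrite mulmxA; apply: rle_trans k2 (rle_mulr _ h2).
Qed.

Lemma sl_equiv_same_rows m p n (K : 'M[R]_(m, n)) (L : 'M[R]_(p, n)) :
  same_rows K L -> sl_equiv K L.
Proof. by move=> [h1 h2]; exists 1%:M; rewrite det1 mulmx1. Qed.

(** The ideal is a predicate [Q], so that determinants can be compared modulo contents, colon ideals
    and annihilators without forming a quotient ring. *)
Lemma det_cong (Q : R -> Prop) n (A B : 'M[R]_n) :
  Q 0 -> (forall x y, Q x -> Q y -> Q (x + y)) -> (forall a x, Q x -> Q (a * x)) ->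
  (forall i j, Q (A i j - B i j)) -> Q (\det A - \det B).
Proof.
move=> Q0 QD QM h; rewrite /determinant -sumrB.
elim/big_rec: _ => // s x _ Qx; apply: (QD) => //.
rewrite -mulrBr; apply: (QM).
elim/big_rec2: _ => [|i y z _ Qyz]; first by rewrite subrr.
have := h i (s i); move: (A i _) (B i _) => a b Qab.
have -> : a * z - b * y = z * (a - b) + b * (z - y) by ring.
by apply: (QD); apply: (QM).
Qed.

End RowSpaces.

(** * Generating families as surjections from free modules *)

Section Modules.
Variable R : comPzRingType.

Definition lin_comb (M : lmodType R) n (v : {ffun 'I_n -> M}) (x : 'rV[R]_n) : M :=
  \sum_i x 0 i *: v i.

Lemma lin_combD (M : lmodType R) n (v : {ffun 'I_n -> M}) x y :
  lin_comb v (x + y) = lin_comb v x + lin_comb v y.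
Proof.
by rewrite /lin_comb -big_split; apply: eq_bigr => i _; rewrite mxE scalerDl.
Qed.

Lemma lin_combZ (M : lmodType R) n (v : {ffun 'I_n -> M}) a x :
  lin_comb v (a *: x) = a *: lin_comb v x.
Proof.
by rewrite /lin_comb scaler_sumr; apply: eq_bigr => i _; rewrite mxE scalerA.
Qed.

Lemma lin_combB (M : lmodType R) n (v : {ffun 'I_n -> M}) x y :
  lin_comb v (x - y) = lin_comb v x - lin_comb v y.
Proof. by rewrite -[- y]scaleN1r lin_combD lin_combZ scaleN1r. Qed.

Lemma lin_comb_delta (M : lmodType R) n (v : {ffun 'I_n -> M}) i :
  lin_comb v (delta_mx 0 i) = v i.
Proof.
rewrite /lin_comb (bigD1 i) //= mxE !eqxx scale1r big1 ?addr0 // => j ji.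
by rewrite mxE (negPf ji) andbF scale0r.
Qed.

Lemma spanP (M : lmodType R) n (v : {ffun 'I_n -> M}) x :
  Defs.span v x <-> exists c, x = lin_comb v c.
Proof.
split=> [[c ->]|[c ->]].
  by exists (\row_i c i); apply: eq_bigr => i _; rewrite mxE.
by exists [ffun i => c 0 i]; apply: eq_bigr => i _; rewrite ffunE.
Qed.

Lemma lin_comb_mul (M : lmodType R) n p (w : {ffun 'I_p -> M})
   (v : {ffun 'I_n -> M}) (G : 'M[R]_(n, p)) (x : 'rV[R]_n) :
  (forall i, v i = lin_comb w (row i G)) ->
  lin_comb w (x *m G) = lin_comb v x.
Proof.
move=> vE; rewrite {2}/lin_comb.
under eq_bigr do rewrite vE -lin_combZ.
rewrite mulmx_sum_row.
elim/big_rec2: _ => [|i y z _ <-]; last by rewrite lin_combD.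
by rewrite /lin_comb big1 // => i _; rewrite mxE scale0r.
Qed.

Lemma lin_comb_linear (M : lmodType R) n (phi : {linear 'rV[R]_n -> M}) x :
  phi x = lin_comb [ffun i => phi (delta_mx 0 i)] x.
Proof.
rewrite {1}[x]row_sum_delta linear_sum; apply: eq_bigr => i _.
by rewrite linearZ ffunE.
Qed.

Lemma lin_comb_lift (M : lmodType R) n p (w : {ffun 'I_p -> M})
   (v : {ffun 'I_n -> M}) : (forall i, Defs.span w (v i)) ->
  exists G : 'M[R]_(n, p), forall x, lin_comb w (x *m G) = lin_comb v x.
Proof.
move=> h; have {h}/(@fin_all_exists _ (fun=> 'rV_p))[g gE] :
   forall i, exists c, v i = lin_comb w c by move=> i; apply/spanP.
exists (\matrix_i g i) => x.
by apply: lin_comb_mul => i; rewrite rowK.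
Qed.

(* Schanuel's argument: lifting the two families of generators through each   *)
(* other presents the kernel of the second map.                               *)
Lemma fg_relations (M : lmodType R) (N : M -> Prop) n (v : {ffun 'I_n -> M}) :
  finitely_presented_sub N -> (forall x, N x <-> Defs.span v x) ->
  exists k (K : 'M[R]_(k, n)), forall x, lin_comb v x = 0 <-> rle x K.
Proof.
move=> [p [phi [phiN [k [r kerE]]]]] vN.
have vspan i : Defs.span v (v i).
  by apply/spanP; exists (delta_mx 0 i); rewrite lin_comb_delta.
set e := [ffun i => phi (delta_mx 0 i)].
have [G GE] : exists G : 'M[R]_(n, p), forall x, phi (x *m G) = lin_comb v x.
  have [i|G GE] := @lin_comb_lift M n p e v; last first.
    by exists G => x; rewrite lin_comb_linear GE.
  have /vN/phiN[u <-] := vspan i.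
  by apply/spanP; exists u; rewrite -lin_comb_linear.
have [H HE] : exists H : 'M[R]_(p, n), forall x, lin_comb v (x *m H) = phi x.
  have [i|H HE] := @lin_comb_lift M p n v e; last first.
    by exists H => x; rewrite lin_comb_linear HE.
  by apply/vN/phiN; rewrite ffunE; exists (delta_mx 0 i).
pose r' := \matrix_i r i.
have rE u : Defs.span r u <-> rle u r'.
  split=> [/spanP[c ->]|[c ->]].
    exists c; rewrite mulmx_sum_row; apply: eq_bigr => i _.
    by rewrite rowK.
  apply/spanP; exists c; rewrite mulmx_sum_row; apply: eq_bigr => i _.
  by rewrite rowK.
exists (n + k)%N, (col_mx (G *m H - 1%:M) (r' *m H)) => x; split=> [vx|].
  have -> : x = x *m G *m H - x *m (G *m H - 1%:M).
    by rewrite mulmxBr mulmx1 mulmxA opprB addrC subrK.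
  apply: rleB; last by apply: rle_usub; apply: rle_mul.
  apply: rle_dsub; apply: rle_mulr; apply/rE/kerE.
  by rewrite /= GE.
move=> [u ->]; rewrite -[u]hsubmxK mul_row_col lin_combD mulmxBr mulmx1 !mulmxA.
rewrite lin_combB !HE GE subrr add0r.
by apply/kerE/rE/rle_mul.
Qed.

Definition sl_cancel_ring := forall n m p (K : 'M[R]_(m, n)) (L : 'M[R]_(p, n)),
  miso K L -> sl_equiv K L.

(** If [A] maps the relations of v onto those of w, then x -> x A descends to an automorphism f of
    M. The witness is a transpose because [sl_act] reads columns and [lin_comb] reads rows. *)
Lemma sl_cancel_transitive (M : lmodType R) n :
  sl_cancel_ring -> finitely_presented M -> aut_sl_transitive M n.
Proof.
move=> hR fpM v w gv gw.
have [k [K KE]] : exists k (K : 'M[R]_(k, n)), forall x, lin_comb v x = 0 <-> rle x K.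
  by apply: (fg_relations fpM) => x; split=> // _; apply: gv.
have [l [L LE]] : exists k (K : 'M[R]_(k, n)), forall x, lin_comb w x = 0 <-> rle x K.
  by apply: (fg_relations fpM) => x; split=> // _; apply: gw.
have [G GE] := lin_comb_lift (fun i => gw (v i)).
have [H HE] := lin_comb_lift (fun i => gv (w i)).
have KL : miso K L.
  exists G, H; split; apply: rle_rows => i.
  - by rewrite row_mul; apply/LE; rewrite GE; apply/KE; rewrite rowE; apply: rle_mul.
  - by rewrite row_mul; apply/KE; rewrite HE; apply/LE; rewrite rowE; apply: rle_mul.
  - by apply/KE; rewrite linearB /= row_mul lin_combB HE [row i G]rowE GE row1 subrr.
  - by apply/LE; rewrite linearB /= row_mul lin_combB GE [row i H]rowE HE row1 subrr.
have [A [dA h1 h2]] := hR _ _ _ _ _ KL.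
have [AA' A'A] := det1_inv dA.
have vw x : lin_comb v x = 0 <-> lin_comb w (x *m A) = 0.
  split=> [/KE kx|/LE lx]; first by apply/LE; apply: rle_trans h1; apply: rle_mulr.
  apply/KE; rewrite -[x]mulmx1 -AA' mulmxA.
  have := rle_mulr (\adj A) (rle_trans lx h2).
  by rewrite -[K *m A *m _]mulmxA AA' mulmx1.
have vrep y : exists x, y = lin_comb v x by apply/spanP; apply: gv.
pose c y := projT1 (cid (vrep y)).
have cE y : lin_comb v (c y) = y by rewrite /c; case: cid.
pose f y := lin_comb w (c y *m A).
have fE x : f (lin_comb v x) = lin_comb w (x *m A).
  apply/eqP; rewrite -subr_eq0 -lin_combB -mulmxBl; apply/eqP/vw.
  by rewrite lin_combB cE subrr.
have f_lin : linear f.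
  move=> a x y; rewrite -[x]cE -[y]cE -lin_combZ -lin_combD !fE.
  by rewrite mulmxDl lin_combD -scalemxAl lin_combZ.
pose fL := GRing.isLinear.Build R M M *:%R f f_lin.
pose f' : {linear M -> M} := HB.pack f fL.
exists f', (\adj A)^T; split.
- have wrep y : exists x, y = lin_comb w x by apply/spanP; apply: gw.
  pose d y := projT1 (cid (wrep y)).
  have dE y : lin_comb w (d y) = y by rewrite /d; case: cid.
  exists (fun y => lin_comb v (d y *m \adj A)) => y /=; last first.
    by rewrite fE -mulmxA A'A mulmx1 dE.
  rewrite -[y]cE fE; apply/eqP; rewrite -subr_eq0 -lin_combB; apply/eqP/vw.
  rewrite mulmxBl -mulmxA A'A mulmx1 lin_combB dE subrr //.
- rewrite det_tr; have := congr1 determinant AA'.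
  by rewrite det_mulmx dA mul1r det1.
apply/ffunP => j; rewrite !ffunE /=.
have -> : \sum_i (\adj A)^T i j *: v i = lin_comb v (row j (\adj A)).
  by apply: eq_bigr => i _; rewrite !mxE.
by rewrite fE -row_mul A'A row1 lin_comb_delta.
Qed.

End Modules.

(** * Elementary divisor rings *)

Section ElementaryDivisor.
Variable R : comPzRingType.

Definition divisor_chain n (d : 'rV[R]_n) :=
  forall i j : 'I_n, (i <= j)%N -> exists c, d 0 i = c * d 0 j.

Lemma edr_normal_form (hR : elementary_divisor_ring R) k n (K : 'M[R]_(k, n)) :
  exists (C C' : 'M[R]_n) (d : 'rV[R]_n),
    [/\ C *m C' = 1%:M, C' *m C = 1%:M, divisor_chain d
      & same_rows (K *m C) (diag_mx d)].
Proof.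
(* The n appended zero rows give every column its diagonal entry, so that the diagonal is a vector
   of length n. *)
have [B [C [[B' [_ B'B]] [C' [CC' C'C]] Doff Ddiv]]] := hR _ _ (col_mx K (0 : 'M_n)).
set D := B *m _ *m C in Doff Ddiv.
pose w (j : 'I_n) : 'I_(k + n) := Ordinal (ltn_addl k (ltn_ord j)).
pose d : 'rV[R]_n := \row_j D (w j) j.
have DE i j : D i j = (i == w j)%:R * d 0 j.
  rewrite [d _ _]mxE; case: eqP => [->|ij]; first by rewrite mul1r.
  by rewrite mul0r Doff // => ij'; apply: ij; apply: val_inj.
exists C, C', d; split=> //.
  move=> i j; have [t] := ubnP (j - i)%N; elim: t i => // t IH i ijt ij.
  have [->|ij'] := eqVneq i j; first by exists 1; rewrite mul1r.
  have lij : (i < j)%N by rewrite ltn_neqAle ij' ij.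
  have li : (i.+1 < n)%N := leq_ltn_trans lij (ltn_ord j).
  have [||c cE] := IH (Ordinal li) => //=.
    by rewrite subnS prednK ?subn_gt0.
  have [//|//|//|c' e] := Ddiv (w i) (w (Ordinal li)) i (Ordinal li).
  exists (c' * c); rewrite -mulrA -cE [d 0 i]mxE e.
  by rewrite [d _ _]mxE.
have KD : same_rows (K *m C) D.
  split.
    have -> : K *m C = row_mx 1%:M 0 *m (B' *m D).
      rewrite /D !mulmxA -[row_mx _ _ *m B' *m B]mulmxA B'B mulmx1.
      by rewrite mul_row_col mul1mx mulmx0 addr0.
    by apply: rle_mull; apply: rle_mul.
  rewrite /D -mulmxA; apply: rle_mull; rewrite mul_col_mx mul0mx.
  by apply: rle_col; [apply: rle_refl|apply: rle0].
have Dd : same_rows D (diag_mx d).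
  move: (D) (d) DE => D' d' D'E; split.
    exists (\matrix_(i, j) (i == w j)%:R); apply/matrixP => i j.
    by rewrite mul_mx_diag !mxE D'E.
  exists (\matrix_(j, i) (i == w j)%:R); apply/matrixP => i j.
  rewrite [RHS]mxE (bigD1 (w i)) //= big1 => [|l li]; last first.
    by rewrite mxE (negPf li) mul0r.
  rewrite !mxE eqxx mul1r addr0 D'E; have -> : (w i == w j) = (i == j) by [].
  by rewrite mulrC mulr_natr; case: eqP => [->|].
by case: KD Dd => [? ?] [? ?]; split; apply: rle_trans; eauto.
Qed.

Lemma divisor_chain_miso n (d d' : 'rV[R]_n) :
  divisor_chain d -> divisor_chain d' ->
  miso (diag_mx d) (diag_mx d') -> rle (diag_mx d) (diag_mx d').
Proof.
move=> cd cd' [G [H [[X XE] _ _ [Y YE]]]].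
suff /fin_all_exists[c cE] : forall k, exists c, d 0 k = c * d' 0 k.
  exists (diag_mx (\row_k c k)); apply/matrixP => i j.
  rewrite mul_mx_diag !mxE cE.
  by case: eqP => [->|_]; rewrite ?mulr1n // !mulr0n mul0r.
have GE i j : d 0 i * G i j = X i j * d' 0 j.
  by have := congr1 (fun A : 'M_n => A i j) XE; rewrite mul_diag_mx mul_mx_diag !mxE.
have HE i j : \sum_l H i l * G l j - (i == j)%:R = Y i j * d' 0 j.
  by have := congr1 (fun A : 'M_n => A i j) YE; rewrite mul_mx_diag !mxE.
move=> k.
(* Modulo Q = (d'_k : d_k), the product HG restricted to the columns j <= k   *)
(* is the identity, but it only involves the rows l < k of G: it is singular, *)
(* so that 1 belongs to Q.                                                    *)
pose Q x := exists c, d 0 k * x = c * d' 0 k.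
have Q0 : Q 0 by exists 0; rewrite mulr0 mul0r.
have QD x y : Q x -> Q y -> Q (x + y).
  by move=> [a ea] [b eb]; exists (a + b); rewrite mulrDr ea eb mulrDl.
have QM a x : Q x -> Q (a * x).
  by move=> [b eb]; exists (a * b); rewrite mulrCA eb mulrA.
have Qd (j : 'I_n) : (j <= k)%N -> Q (d' 0 j).
  by move=> /cd'[c ->]; exists (d 0 k * c); rewrite mulrA.
pose U : 'M[R]_n := \matrix_(i, l)
  if (l < k)%N then H i l else if (l == k) then 0 else (i == l)%:R.
pose V : 'M[R]_n := \matrix_(l, j)
  if (l < k)%N then (if (j <= k)%N then G l j else 0) else (l == j)%:R.
have UV0 : \det (U *m V) = 0.
  rewrite det_mulmx (expand_det_col _ k) big1 ?mul0r // => i _.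
  by rewrite mxE ltnn eqxx mul0r.
have : Q (\det (1%:M : 'M[R]_n) - \det (U *m V)).
  apply: det_cong => // i j; rewrite !mxE.
  have [jk|kj] := leqP j k; last first.
    rewrite (bigD1 j) //= big1 => [|l lj]; last first.
      rewrite !mxE; case: ifP => lk; first by rewrite leqNgt kj mulr0.
      by rewrite (negPf lj) mulr0.
    have nk : (j == k) = false by apply/negP => /eqP e; rewrite e ltnn in kj.
    by rewrite !mxE ltnNge (ltnW kj) /= nk eqxx mulr1 addr0 subrr.
  have -> : (i == j)%:R - \sum_l U i l * V l j =
     \sum_(l < n | (k <= l)%N) H i l * G l j - Y i j * d' 0 j.
    rewrite -HE [X in _ - (X - _)](bigID (fun l : 'I_n => (k <= l)%N)) /=.
    rewrite [X in _ - (_ + X - _)](_ : _ = \sum_l U i l * V l j).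
      by ring.
    rewrite [RHS](bigID (fun l : 'I_n => (k <= l)%N)) /= [X in _ = X + _]big1.
      rewrite add0r; apply: eq_bigr => l; rewrite -ltnNge => lk.
      by rewrite !mxE lk jk.
    move=> l kl; rewrite !mxE ltnNge kl /=; case: eqP => [_|lk]; first by rewrite mul0r.
    have -> : (l == j) = false.
      apply/negP => /eqP e; apply: lk; apply: val_inj => /=.
      by apply/eqP; rewrite eqn_leq kl e jk.
    by rewrite mulr0.
  apply: (QD); last by rewrite -mulNr; apply: (QM); apply: Qd.
  elim/big_rec: _ => // l x kl Qx; apply: (QD) => //; apply: (QM).
  have [c dk] := cd _ _ kl; have [c' dj] := cd' _ _ jk.
  by exists (c * X l j * c'); rewrite dk -mulrA GE dj; ring.
by rewrite det1 UV0 subr0 => -[c]; rewrite mulr1 => ->; exists c.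
Qed.

Lemma edr_sl_cancel : elementary_divisor_ring R -> sl_cancel_ring R.
Proof.
move=> hR [|n] m p K L KL.
  by exists 1%:M; rewrite det1; split=> //; exists 0; apply/matrixP => ? [].
have [C [C' [d [CC' C'C cd Kd]]]] := edr_normal_form hR K.
have [E [E' [d' [EE' E'E cd' Ld']]]] := edr_normal_form hR L.
have dd' : miso (diag_mx d) (diag_mx d').
  apply: miso_trans (miso_mulr EE' E'E Ld').
  by apply: miso_trans KL; apply: miso_sym; apply: (miso_mulr CC' C'C Kd).
have ld := divisor_chain_miso cd cd' dd'.
have ld' := divisor_chain_miso cd' cd (miso_sym dd').
(* This unit gives C diag(u, 1, ..., 1) E' determinant 1; the middle factor commutes with diag d,
   hence preserves its row space. *)
pose u := \det C' * \det E.
pose dU : 'rV[R]_n.+1 := \row_j if j == 0 then u else 1.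
have detU : \det (diag_mx dU) = u.
  rewrite det_diag (bigD1 ord0) //= big1 => [|j j0]; first by rewrite !mxE mulr1.
  by rewrite mxE (negPf j0).
have du : \det C * u * \det E' = 1.
  have := congr1 determinant CC'; have := congr1 determinant EE'.
  rewrite !det_mulmx det1 /u => e1 e2.
  by transitivity ((\det C * \det C') * (\det E * \det E')); [ring|rewrite e1 e2 mulr1].
have dU' : exists V : 'M[R]_n.+1, V *m diag_mx dU = 1%:M.
  exists (diag_mx (\row_j if j == 0 then \det C * \det E' else 1)).
  rewrite mulmx_diag -diag_const_mx; congr diag_mx; apply/rowP => j; rewrite !mxE.
  by case: eqP => // _; rewrite ?mulr1 // -du; ring.
case: dU' => V VU; exists (C *m diag_mx dU *m E'); split.
- by rewrite !det_mulmx detU.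
- rewrite !mulmxA; apply: (rle_trans (B := diag_mx d' *m E')); last first.
    by apply: rle_trans (rle_mulr E' Ld'.2) _; rewrite -mulmxA EE' mulmx1; apply: rle_refl.
  apply: rle_mulr; apply: rle_trans ld.
  by apply: rle_trans (rle_mulr _ Kd.1) _; rewrite diag_mxC; apply: rle_mul.
- rewrite !mulmxA; apply: (rle_trans (B := diag_mx d' *m E')).
    by apply: rle_trans (rle_mulr E' Ld'.1); rewrite -mulmxA EE' mulmx1; apply: rle_refl.
  apply: rle_mulr; apply: rle_trans ld' _.
  apply: rle_trans (rle_mulr _ Kd.2).
  by exists V; rewrite diag_mxC mulmxA VU mul1mx.
Qed.

End ElementaryDivisor.

(** * Content ideals *)

Section Content.
Variable R : comPzRingType.

Definition content m n (B : 'M[R]_(m, n)) (x : R) : Prop :=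
  exists W : 'M[R]_(n, m), x = \tr (W *m B).

Lemma content0 m n (B : 'M[R]_(m, n)) : content B 0.
Proof. by exists 0; rewrite mul0mx mxtrace0. Qed.

Lemma contentD m n (B : 'M[R]_(m, n)) x y :
  content B x -> content B y -> content B (x + y).
Proof. by move=> [V ->] [W ->]; exists (V + W); rewrite mulmxDl mxtraceD. Qed.

Lemma contentM m n (B : 'M[R]_(m, n)) a x : content B x -> content B (a * x).
Proof. by move=> [V ->]; exists (a *: V); rewrite -scalemxAl mxtraceZ. Qed.

Lemma content_sum m n (B : 'M[R]_(m, n)) (I : Type) (r : seq I) (P : pred I)
  (F : I -> R) :
  (forall i, P i -> content B (F i)) -> content B (\sum_(i <- r | P i) F i).
Proof.
move=> h; elim/big_rec: _ => [|i x Pi hx]; first exact: content0.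
by apply: contentD => //; apply: h.
Qed.

Lemma content_entry m n (B : 'M[R]_(m, n)) i j : content B (B i j).
Proof.
exists (delta_mx j i); rewrite /mxtrace (bigD1 j) //= big1 => [|l lj].
  rewrite mxE (bigD1 i) //= big1 => [|l li]; first by rewrite mxE !eqxx mul1r !addr0.
  by rewrite mxE (negPf li) andbF mul0r.
by rewrite mxE big1 // => l' _; rewrite mxE (negPf lj) mul0r.
Qed.

Lemma contentE m n (B : 'M[R]_(m, n)) (Q : R -> Prop) x :
  Q 0 -> (forall x y, Q x -> Q y -> Q (x + y)) -> (forall a x, Q x -> Q (a * x)) ->
  (forall i j, Q (B i j)) -> content B x -> Q x.
Proof.
move=> Q0 QD QM QB [W ->].
rewrite /mxtrace; elim/big_rec: _ => // i y _ Qy; apply: (QD) => //; rewrite mxE.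
by elim/big_rec: _ => // j z _ Qz; apply: (QD) => //; apply: (QM).
Qed.

Lemma content_sub m n p q (B : 'M[R]_(m, n)) (C : 'M[R]_(p, q)) x :
  (forall i j, content C (B i j)) -> content B x -> content C x.
Proof.
by apply: contentE; [apply: content0|apply: contentD|apply: contentM].
Qed.

Lemma content_mull m n p (X : 'M[R]_(m, n)) (B : 'M[R]_(n, p)) i j :
  content B ((X *m B) i j).
Proof. by rewrite mxE; apply: content_sum => l _; apply/contentM/content_entry. Qed.

Lemma content_mulr m n p (B : 'M[R]_(m, n)) (X : 'M[R]_(n, p)) i j :
  content B ((B *m X) i j).
Proof.
by rewrite mxE; apply: content_sum => l _; rewrite mulrC; apply/contentM/content_entry.
Qed.

Lemma content_rle m n p (B : 'M[R]_(m, n)) (C : 'M[R]_(p, n)) x :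
  rle B C -> content B x -> content C x.
Proof. by move=> [X ->]; apply: content_sub => i j; apply: content_mull. Qed.

(** Invariance of a Fitting ideal: modulo the content of L, det(HG) is 1, while det(HG) K is a
    multiple of K G and thus vanishes. *)
Lemma content_miso m p n (K : 'M[R]_(m, n)) (L : 'M[R]_(p, n)) x :
  miso K L -> content K x -> content L x.
Proof.
move=> [G [H [[X KG] _ _ [Y HG]]]]; apply: content_sub => i j.
have dL : content L (\det (H *m G) - \det (1%:M : 'M[R]_n)).
  apply: det_cong => [||a y|i' j']; [exact: content0|exact: contentD|exact: contentM|].
  have -> : (H *m G) i' j' - (1%:M : 'M[R]_n) i' j' = (H *m G - 1%:M) i' j'.
    by rewrite !mxE.
  by rewrite HG; apply: content_mull.
have dK : content L (\det (H *m G) * K i j).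
  have -> : \det (H *m G) * K i j = (K *m G *m (\det H *: \adj G)) i j.
    by rewrite -scalemxAr -mulmxA mul_mx_adj mul_mx_scalar scalerA det_mulmx mxE.
  rewrite KG -mulmxA mulmxA; apply: content_sub (content_mulr _ _ _ _) => i' j'.
  exact: content_mull.
have -> : K i j = \det (H *m G) * K i j +
   (- K i j) * (\det (H *m G) - \det (1%:M : 'M[R]_n)) by rewrite det1; ring.
by apply: contentD => //; apply: contentM.
Qed.

Definition regular (s : R) := forall x, s * x = 0 -> x = 0.

Definition faithful (I : Type) (a : I -> R) :=
  forall x, (forall i, a i * x = 0) -> x = 0.

Definition rank_le1 m n (B : 'M[R]_(m, n)) :=
  forall i i' j j', B i j * B i' j' = B i j' * B i' j.

Definition minor2 m n (B : 'M[R]_(m, n)) (k : 'I_m * 'I_m * ('I_n * 'I_n)) :=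
  B k.1.1 k.2.1 * B k.1.2 k.2.2 - B k.1.1 k.2.2 * B k.1.2 k.2.1.

Lemma mulr_eq_sum m n (F : 'I_(m * n) -> R) :
  \sum_r F r = \sum_p \sum_l F (mxvec_index p l).
Proof.
rewrite pair_bigA; rewrite (reindex _ (curry_mxvec_bij _ _)) /=.
by apply: eq_bigr => -[p l].
Qed.

End Content.

(** * Idempotents and invertible ideals *)

Section PrincipalAnnihilators.
Variable R : comPzRingType.
Hypothesis pp : forall a : R,
  exists e, e * e = e /\ forall x, a * x = 0 <-> e * x = x.

(** The family is traded for one element with the same annihilator: [a i] is regular on the
    component [ep i]. In the induction, [a ord0] serves where the later elements vanish (1 - f) and
    it is itself regular (1 - e). *)
Lemma orthogonal_idempotents k (a : 'I_k -> R) :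
  exists ep : 'I_k -> R, exists f, [/\ f = \sum_i ep i,
    forall i j, ep i * ep j = (i == j)%:R * ep i, forall i, f * a i = a i,
    forall x, (forall i, a i * x = 0) -> f * x = 0
  & forall x, (\sum_i ep i * a i) * x = 0 -> forall i, a i * x = 0].
Proof.
elim: k a => [|k IH] a.
  by exists (fun=> 0), 0; rewrite big_ord0; split=> [//|[]//|[]//|x _|x _ []//]; rewrite mul0r.
have [ep [f [fE epM fa fx sx]]] := IH (fun i => a (lift ord0 i)).
have [e [ee eP]] := pp (a ord0).
have fep i : f * ep i = ep i.
  rewrite fE mulr_suml (bigD1 i) //= epM eqxx mul1r big1 ?addr0 // => j ji.
  by rewrite epM (negPf ji) mul0r.
have ff : f * f = f by rewrite {2 3}fE mulr_sumr; apply: eq_bigr.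
have ae : a ord0 * e = 0 by apply/eP.
have kill x : f * x = x -> (1 - f) * (1 - e) * x = 0.
  by move=> fx'; rewrite mulrAC mulrBl fx' mul1r subrr mul0r.
pose ep' i := oapp ep ((1 - f) * (1 - e)) (unlift ord0 i).
have ep0 : ep' ord0 = (1 - f) * (1 - e) by rewrite /ep' unlift_none.
have epl i : ep' (lift ord0 i) = ep i by rewrite /ep' liftK.
exists ep', (f + (1 - f) * (1 - e)); split.
- by rewrite big_ord_recl ep0 addrC fE; congr (_ + _); apply: eq_bigr => i _; rewrite epl.
- move=> i j; case: (unliftP ord0 i) => [i' ->|->];
    case: (unliftP ord0 j) => [j' ->|->]; rewrite ?ep0 ?epl.
  + by rewrite (inj_eq lift_inj) epM.
  + rewrite mulrA [ep i' * _]mulrBr mulr1 [ep i' * f]mulrC fep subrr mul0r.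
    by rewrite eq_sym (negPf (neq_lift _ _)) mul0r.
  + by rewrite kill // (negPf (neq_lift _ _)) mul0r.
  + rewrite eqxx mul1r.
    have -> : (1 - f) * (1 - e) * ((1 - f) * (1 - e)) =
      (1 - f - f + f * f) * (1 - e - e + e * e) by ring.
    by rewrite ff ee; ring.
- move=> i; case: (unliftP ord0 i) => [i' ->|->].
    by rewrite mulrDl fa kill ?addr0.
  have -> : (f + (1 - f) * (1 - e)) * a ord0 = a ord0 - (1 - f) * (a ord0 * e) by ring.
  by rewrite ae mulr0 subr0.
- move=> x ax; rewrite mulrDl fx // add0r -mulrA [(1 - e) * x]mulrBl mul1r.
  by have /eP -> := ax ord0; rewrite subrr mulr0.
move=> x; rewrite big_ord_recl ep0.
under eq_bigr do rewrite epl.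
set s := \sum_i _ => e1.
have sf : f * s = s by rewrite mulr_sumr; apply: eq_bigr => i _; rewrite mulrA fep.
have {}e1 : s * x + (1 - f) * (a ord0 * x) = 0.
  rewrite -[RHS]e1.
  have -> : ((1 - f) * (1 - e) * a ord0 + s) * x =
     s * x + (1 - f) * (a ord0 * x) - (1 - f) * x * (a ord0 * e) by ring.
  by rewrite ae mulr0 subr0.
have sx0 : s * x = 0.
  have : f * (s * x + (1 - f) * (a ord0 * x)) = f * s * x + (f - f * f) * (a ord0 * x).
    by ring.
  by rewrite e1 mulr0 sf ff subrr mul0r addr0.
have ax := sx _ sx0.
have fx0 := fx _ ax.
move=> i; case: (unliftP ord0 i) => [i' ->|->]; first exact: ax.
move: e1; rewrite sx0 add0r mulrBl mul1r.
by rewrite mulrCA fx0 mulr0 subr0.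
Qed.

Lemma orthogonal_idempotents_fin (I : finType) (a : I -> R) :
  exists ep : I -> R, exists f, [/\ f = \sum_i ep i,
    forall i j, ep i * ep j = (i == j)%:R * ep i, forall i, f * a i = a i,
    forall x, (forall i, a i * x = 0) -> f * x = 0
  & forall x, (\sum_i ep i * a i) * x = 0 -> forall i, a i * x = 0].
Proof.
have [ep [f [fE epM fa fx sx]]] := orthogonal_idempotents (fun i : 'I_#|I| => a (enum_val i)).
have re (F : 'I_#|I| -> R) : \sum_i F i = \sum_x F (enum_rank x).
  rewrite (reindex enum_rank) //=.
  by exists enum_val => i _; rewrite ?enum_rankK ?enum_valK.
exists (fun x => ep (enum_rank x)), f; split.
- by rewrite fE re.
- by move=> i j; rewrite epM (inj_eq enum_rank_inj).
- by move=> i; have := fa (enum_rank i); rewrite enum_rankK.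
- by move=> x ax; apply: fx => i; apply: ax.
move=> x xs i; have := sx x _ (enum_rank i); rewrite enum_rankK re; apply.
by under eq_bigr do rewrite enum_rankK.
Qed.

Lemma faithful_regular (I : finType) (a : I -> R) : faithful a ->
  exists ep : I -> R, (forall i j, ep i * ep j = (i == j)%:R * ep i) /\
    regular (\sum_i ep i * a i).
Proof.
move=> fa; have [ep [f [_ epM _ _ sx]]] := orthogonal_idempotents_fin a.
by exists ep; split=> // x /sx; apply: fa.
Qed.

Lemma support_idempotent (I : finType) (a : I -> R) :
  exists f, [/\ f * f = f, forall i, f * a i = a i &
    forall x, (forall i, a i * x = 0) -> f * x = 0].
Proof.
have [ep [f [fE epM fa fx sx]]] := orthogonal_idempotents_fin a.
exists f; split=> //; rewrite {2 3}fE mulr_sumr; apply: eq_bigr => i _.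
rewrite fE mulr_suml (bigD1 i) //= epM eqxx mul1r big1 ?addr0 // => j ji.
by rewrite epM (negPf ji) mul0r.
Qed.

Hypothesis arith : forall a b : R,
  exists t c d, t * b = c * a /\ (1 - t) * a = d * b.

(** A partition of unity such that [a i] generates the ideal where [t i] is invertible. The
    induction compares [a ord0] with each later element and hands it the share t i (1 - u i); [t0]
    is 1 for the empty family. *)
Lemma locally_principal k (a : 'I_k -> R) :
  exists t : 'I_k -> R, exists t0, [/\ t0 + \sum_i t i = 1,
    forall j, t0 * a j = 0 & forall i j, exists c, t i * a j = c * a i].
Proof.
elim: k a => [|k IH] a.
  by exists (fun=> 0), 1; rewrite big_ord0 addr0; split=> [//|[]//|[]//].
have [t [t0 [t1 ta tc]]] := IH (fun i => a (lift ord0 i)).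
have /fin_all_exists[u uP] : forall i : 'I_k, exists u, exists c d,
    u * a ord0 = c * a (lift ord0 i) /\ (1 - u) * a (lift ord0 i) = d * a ord0.
  by move=> i; apply: arith.
pose t' i := oapp (fun i => t i * u i) (t0 + \sum_i t i * (1 - u i)) (unlift ord0 i).
have t'0 : t' ord0 = t0 + \sum_i t i * (1 - u i) by rewrite /t' unlift_none.
have t'l i : t' (lift ord0 i) = t i * u i by rewrite /t' liftK.
exists t', 0; split=> [|j|i j]; last 2 first.
- by rewrite mul0r.
- case: (unliftP ord0 i) => [i' ->|->]; rewrite ?t'l.
    case: (unliftP ord0 j) => [j' ->|->].
      have [c e] := tc i' j'; exists (u i' * c).
      by rewrite mulrAC e -mulrA mulrC mulrA.
    have [c [d [e _]]] := uP i'; exists (t i' * c).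
    by rewrite -mulrA e mulrA.
  case: (unliftP ord0 j) => [j' ->|->]; last by exists (t' ord0).
  have h i' : exists c, t i' * (1 - u i') * a (lift ord0 j') = c * a ord0.
    have [c e] := tc i' j'; have [_ [d [_ e']]] := uP i'; exists (c * d).
    by rewrite mulrAC e -!mulrA -e'; ring.
  have [c cE] := fin_all_exists h.
  exists (\sum_i c i); rewrite t'0 mulrDl ta add0r !mulr_suml.
  by apply: eq_bigr => i' _.
rewrite add0r big_ord_recl t'0 -addrA -big_split /= -[RHS]t1; congr (_ + _).
by apply: eq_bigr => l _; rewrite t'l; ring.
Qed.

(* s^-1 q_i are generators of the inverse of the ideal (a_1, ..., a_k).        *)
Lemma invertible_ideal k (a : 'I_k -> R) : faithful a ->
  exists s (q : 'I_k -> R) (c : 'I_k -> 'I_k -> R),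
    [/\ regular s, forall i j, q i * a j = s * c i j, \sum_i q i * a i = s
      & \sum_i c i i = 1].
Proof.
move=> fa.
have [w [_ rs]] := faithful_regular fa; set s := \sum_i _ in rs.
have [t [t0 [t1 ta tc]]] := locally_principal a.
have {ta} t00 : t0 = 0 by apply: fa => i; rewrite mulrC ta.
move: t1; rewrite {}t00 add0r => t1.
have [c0 c0E] := fin_all_exists (fun i => fin_all_exists (tc i)).
have [e eP] := fin_all_exists (fun i => pp (a i)).
(* The factor 1 - e i restricts to the part where [a i] is regular, so that identities there can be
   checked after multiplying by [a i]. Then [q i] stands for t i s / a i. *)
pose c i j := (1 - e i) * c0 i j.
pose q i := \sum_k w k * c i k.
have ae i : a i * e i = 0 by case: (eP i) => ee h; apply/h.
have cE i j : t i * a j = c i j * a i.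
  have -> : c i j * a i = c0 i j * a i - c0 i j * (a i * e i) by rewrite /c; ring.
  by rewrite ae mulr0 subr0 c0E.
have qa i : q i * a i = t i * s.
  rewrite mulr_suml mulr_sumr; apply: eq_bigr => l _.
  by rewrite -mulrA -cE; ring.
have ec i j : e i * c i j = 0.
  by case: (eP i) => ee _; rewrite /c mulrA mulrBr mulr1 ee subrr mul0r.
have eq i : e i * q i = 0.
  by rewrite mulr_sumr big1 // => l _; rewrite mulrCA ec mulr0.
have qc i j : q i * a j = s * c i j.
  apply/eqP; rewrite -subr_eq0; apply/eqP.
  case: (eP i) => _ /(_ (q i * a j - s * c i j)) [h _].
  rewrite -h; first by rewrite mulrBr mulrA eq mulrCA ec mul0r mulr0 subrr.
  have -> : a i * (q i * a j - s * c i j) = q i * a i * a j - s * (c i j * a i) by ring.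
  by rewrite qa -cE; ring.
have qs : \sum_i q i * a i = s.
  by under eq_bigr do rewrite qa; rewrite -mulr_suml t1 mul1r.
exists s, q, c; split=> //.
apply/eqP; rewrite -subr_eq0; apply/eqP/rs.
rewrite mulrBr mulr1 mulr_sumr -[X in _ - X]qs -sumrB big1 // => i _.
by rewrite -qc subrr.
Qed.

(* The matrix C presents (K : I), where I is the content of K.                *)
Lemma unit_content m n (K : 'M[R]_(m, n)) :
  faithful (fun p : 'I_m * 'I_n => K p.1 p.2) ->
  exists k (C : 'M[R]_(k, n)) s (Q : 'M[R]_(k, m)) (X : 'M[R]_(m, k)),
    [/\ regular s, s *: C = Q *m K,
        K = X *m C /\ (forall i j, content K (X i j)),
        forall i j, rle (K i j *: C) K & content C 1].
Proof.
move=> fK; pose a p := mxvec K 0 p.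
have [|s [q [c [rs qc qs c1]]]] := @invertible_ideal _ a.
  move=> x ax; apply: fK => -[i j] /=.
  by have := ax (mxvec_index i j); rewrite /a mxvecE.
(* Row (p, l) of [C] is q p / s times row l of K, the q p / s generating the inverse of I. [D x]
   stacks the scalar matrices x p, one for each entry position p of K. *)
pose C := \matrix_(r < m * n * m, j < n)
  mxvec (\matrix_(p, l) c p (mxvec_index l j)) 0 r.
pose D (x : 'I_(m * n) -> R) := \matrix_(r < m * n * m, l' < m)
  mxvec (\matrix_(p, l) (x p *+ (l == l'))) 0 r.
have CE p l j : C (mxvec_index p l) j = c p (mxvec_index l j).
  by rewrite mxE mxvecE mxE.
have DE x p l l' : D x (mxvec_index p l) l' = x p *+ (l == l').
  by rewrite mxE mxvecE mxE.
have DK x p l j : (D x *m K) (mxvec_index p l) j = x p * K l j.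
  rewrite mxE (bigD1 l) //= DE eqxx mulr1n big1 ?addr0 // => l' ll'.
  by rewrite DE eq_sym (negPf ll') mul0r.
exists _, C, s, (D q), (D a)^T; split=> //.
- apply/matrixP => r j; case/mxvec_indexP: r => p l.
  by rewrite DK [LHS]mxE CE; have := qc p (mxvec_index l j); rewrite /a mxvecE => ->.
- split=> [|i r]; last first.
    case/mxvec_indexP: r => p l; rewrite [_^T _ _]mxE DE.
    rewrite -mulr_natr mulrC; apply: contentM.
    by case/mxvec_indexP: p => i' j'; rewrite /a mxvecE; apply: content_entry.
  apply/matrixP => l j; rewrite [RHS]mxE mulr_eq_sum.
  rewrite exchange_big (bigD1 l) //= [X in _ + X]big1 => [|l' ll']; last first.
    by rewrite big1 // => p _; rewrite [_^T _ _]mxE DE (negPf ll') mul0r.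
  rewrite addr0; apply/eqP; rewrite -subr_eq0; apply/eqP/rs.
  rewrite mulrBr -{1}qs mulr_sumr mulr_suml -sumrB big1 // => p _.
  rewrite [_^T _ _]mxE DE eqxx mulr1n CE [s * _]mulrCA.
  by have := qc p (mxvec_index l j); rewrite {1}/a mxvecE => <-; ring.
- move=> i j; exists (D (fun p => c p (mxvec_index i j))).
  apply/matrixP => r l; case/mxvec_indexP: r => p l'.
  rewrite DK [LHS]mxE CE; apply/eqP; rewrite -subr_eq0; apply/eqP/rs.
  rewrite mulrBr [s * (K i j * _)]mulrCA [s * (c _ _ * _)]mulrA.
  have := qc p (mxvec_index l' l); have := qc p (mxvec_index i j).
  by rewrite /a !mxvecE => <- <-; ring.
rewrite -c1; apply: content_sum => p _.
case/mxvec_indexP: p => l j.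
by rewrite -CE; apply: content_entry.
Qed.

End PrincipalAnnihilators.

(** * Cancellation of a cyclic summand *)

Section Blocks.
Variable R : comPzRingType.

Lemma rle_row_block q a n m (x : 'M[R]_(q, 1)) (y : 'M[R]_(q, n))
    (al : 'M[R]_(a, 1)) (K : 'M[R]_(m, n)) :
  rle (row_mx x y) (block_mx al 0 0 K) <-> rle x al /\ rle y K.
Proof.
split=> [[Z]|[[X ->] [Y ->]]]; last first.
  by exists (row_mx X Y); rewrite mul_row_block !mulmx0 addr0 add0r.
rewrite -[Z]hsubmxK mul_row_block !mulmx0 addr0 add0r => /eq_row_mx[-> ->].
by split; apply: rle_mul.
Qed.

Lemma rle_block q1 q2 a n m (x : 'M[R]_(q1, 1)) (y : 'M[R]_(q1, n))
    (z : 'M[R]_(q2, 1)) (t : 'M[R]_(q2, n))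
    (al : 'M[R]_(a, 1)) (K : 'M[R]_(m, n)) :
  rle (block_mx x y z t) (block_mx al 0 0 K) <->
  [/\ rle x al, rle y K, rle z al & rle t K].
Proof.
rewrite -[block_mx x y z t]/(col_mx (row_mx x y) (row_mx z t)).
split=> [[Z e]|[h1 h2 h3 h4]].
  have /rle_row_block[h1 h2] : rle (row_mx x y) (block_mx al 0 0 K).
    by exists (usubmx Z); rewrite mul_usub_mx -e col_mxKu.
  have /rle_row_block[h3 h4] : rle (row_mx z t) (block_mx al 0 0 K).
    by exists (dsubmx Z); rewrite mul_dsub_mx -e col_mxKd.
  by [].
by apply: rle_col; apply/rle_row_block.
Qed.

Lemma rle_mul11 a m (x : 'M[R]_(m, 1)) (al : 'M[R]_(a, 1)) (u : 'M[R]_1) :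
  rle x al -> rle (x *m u) al.
Proof. by rewrite [u]mx11_scalar mul_mx_scalar; apply: rleZ. Qed.

Lemma mulmxC11 (x y : 'M[R]_1) : x *m y = y *m x.
Proof. by rewrite [x]mx11_scalar mul_mx_scalar mul_scalar_mx. Qed.

(** As a row space in R^1, [(mxvec K)^T] is the content I of K; thus [block_mx (mxvec K)^T 0 0 L]
    presents the direct sum of R/I and R^n/L. *)
Lemma rle_content m n (K : 'M[R]_(m, n)) q (y : 'M[R]_(q, 1)) :
  (forall i, content K (y i 0)) -> rle y (mxvec K)^T.
Proof.
move=> h; apply: rle_rows => i.
have -> : row i y = (y i 0)%:M by rewrite [row i y]mx11_scalar mxE.
move: (h i).
apply: (contentE (Q := fun z => rle (z%:M : 'M_1) (mxvec K)^T)) => [|x z hx hz|a x hx|k l].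
- by rewrite raddf0; apply: rle0.
- by rewrite raddfD; apply: rleD.
- by rewrite -scale_scalar_mx; apply: rleZ.
exists (delta_mx 0 (mxvec_index k l)).
rewrite -rowE; apply/rowP => r; rewrite ord1 !mxE eqxx mulr1n.
by rewrite mxvecE.
Qed.

Lemma content_mxvec m n (K : 'M[R]_(m, n)) i : content K ((mxvec K)^T i 0).
Proof. by case/mxvec_indexP: i => k l; rewrite mxE mxvecE; apply: content_entry. Qed.

Lemma block_sl_equiv a n m p (al : 'M[R]_(a, 1)) (K : 'M[R]_(m, n))
    (L : 'M[R]_(p, n)) :
  sl_equiv K L -> sl_equiv (block_mx al 0 0 K) (block_mx al 0 0 L).
Proof.
move=> [A [dA h1 h2]].
exists (block_mx 1%:M 0 0 A : 'M_(1 + n)); split; first by rewrite det_ublock det1 dA mulr1.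
- rewrite mulmx_block !mulmx0 !mul0mx mulmx1 !addr0 add0r.
  by apply/rle_block; split; rewrite // ?mulmx1; try exact: rle0; exact: rle_refl.
- rewrite mulmx_block !mulmx0 !mul0mx mulmx1 !addr0 add0r.
  by apply/rle_block; split; rewrite // ?mulmx1; try exact: rle0; exact: rle_refl.
Qed.

Section Cancellation.
Variables (a n m p : nat) (al : 'M[R]_(a, 1)) (K : 'M[R]_(m, n)) (L : 'M[R]_(p, n)).
Variables (g : 'M[R]_1) (g12 : 'M[R]_(1, n)) (g21 : 'M[R]_(n, 1)) (G22 : 'M[R]_n).
Variables (h : 'M[R]_1) (h12 : 'M[R]_(1, n)) (h21 : 'M[R]_(n, 1)) (H22 : 'M[R]_n).
Let G : 'M_(1 + n) := block_mx g g12 g21 G22.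
Let H : 'M_(1 + n) := block_mx h h12 h21 H22.
Hypothesis KG : rle (block_mx al 0 0 K *m G) (block_mx al 0 0 L).
Hypothesis LH : rle (block_mx al 0 0 L *m H) (block_mx al 0 0 K).
Hypothesis GH : rle (G *m H - 1%:M) (block_mx al 0 0 K).
Hypothesis HG : rle (H *m G - 1%:M) (block_mx al 0 0 L).

Let block1 : (1%:M : 'M[R]_(1 + n)) = block_mx 1%:M 0 0 1%:M.
Proof. by rewrite -scalar_mx_block. Qed.

(* The inverse of a Schur complement is the corresponding block of the inverse. *)
Lemma miso_schur (u : 'M[R]_1) : rle (g *m u - 1%:M) al -> miso K L.
Proof.
move=> gu; have ug : rle (u *m g - 1%:M) al by rewrite mulmxC11.
move: KG; rewrite mulmx_block !mul0mx !addr0 !add0r => /rle_block[_ kg2 kg3 kg4].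
move: LH; rewrite mulmx_block !mul0mx !addr0 !add0r => /rle_block[_ lh2 lh3 lh4].
move: GH; rewrite mulmx_block block1 opp_block_mx add_block_mx !oppr0 !addr0.
move=> /rle_block[_ gh2 gh3 gh4].
move: HG; rewrite mulmx_block block1 opp_block_mx add_block_mx !oppr0 !addr0.
move=> /rle_block[_ hg2 hg3 hg4].
have alK q (x : 'M_(q, 1)) : rle x al -> rle (x *m h12) K.
  by move=> [X ->]; rewrite -mulmxA; apply: rle_mull.
have alL q (x : 'M_(q, 1)) : rle x al -> rle (x *m g12) L.
  by move=> [X ->]; rewrite -mulmxA; apply: rle_mull.
exists (G22 - g21 *m u *m g12), H22; split=> //.
- rewrite mulmxBr; apply: rleB => //; rewrite !mulmxA; apply: alL.
  exact: rle_mul11.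
- have -> : (G22 - g21 *m u *m g12) *m H22 - 1%:M =
     (g21 *m h12 + G22 *m H22 - 1%:M) - g21 *m u *m (g *m h12 + g12 *m H22)
     + g21 *m ((u *m g - 1%:M) *m h12).
    rewrite mulmxBl mulmxDr mulmxBl mul1mx mulmxBr !mulmxA.
    move: (g21 *m h12) (G22 *m H22) (_ *m g *m h12) (_ *m g12 *m H22) 1%:M => x1 x2 x3 x4 x5.
    by apply/matrixP => i j; rewrite !mxE; ring.
  apply: rleD; last by apply: rle_mull; apply: alK.
  by apply: rleB => //; apply: rle_mull.
- have -> : H22 *m (G22 - g21 *m u *m g12) - 1%:M =
     (h21 *m g12 + H22 *m G22 - 1%:M) - (h21 *m g + H22 *m g21) *m u *m g12
     + h21 *m ((g *m u - 1%:M) *m g12).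
    rewrite mulmxBr 2!mulmxDl mulmxBl mul1mx mulmxBr !mulmxA.
    move: (h21 *m g12) (H22 *m G22) (h21 *m g *m u *m g12) (H22 *m g21 *m u *m g12) 1%:M.
    by move=> x1 x2 x3 x4 x5; apply/matrixP => i j; rewrite !mxE; ring.
  apply: rleD; last by apply: rle_mull; apply: alL.
  by apply: rleB => //; apply: alL; apply: rle_mul11.
Qed.

End Cancellation.

End Blocks.

(** * Stable range one modulo regular elements, and Evans' cancellation *)

Section StableRange.
Variable R : comPzRingType.

(* R/Rs has stable range one for every regular s.                             *)
Definition almost_stable := forall s : R, regular s ->
  forall k n (y : 'rV[R]_n) (B : 'M[R]_(k, n)) r,
  content (col_mx y B) (1 - r * s) ->
  exists (t : 'rV[R]_k) r', content (y + t *m B) (1 - r' * s).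

Hypothesis stable : almost_stable.

Lemma content_usub m p n (B : 'M[R]_(m, n)) (C : 'M[R]_(p, n)) x :
  content B x -> content (col_mx B C) x.
Proof. by apply: content_rle; apply: rle_usub; apply: rle_refl. Qed.

Lemma content_dsub m p n (B : 'M[R]_(m, n)) (C : 'M[R]_(p, n)) x :
  content C x -> content (col_mx B C) x.
Proof. by apply: content_rle; apply: rle_dsub; apply: rle_refl. Qed.

(* Evans' cancellation theorem for R/I, where I contains a regular element.   *)
Lemma miso_cancel a n m p (al : 'M[R]_(a, 1)) (K : 'M[R]_(m, n))
    (L : 'M[R]_(p, n)) s :
  regular s -> rle (s%:M : 'M_1) al ->
  miso (block_mx al 0 0 K) (block_mx al 0 0 L) -> miso K L.
Proof.
move=> rs sal [G [H [KG LH GH HG]]].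
move: G H KG LH GH HG; rewrite -[(1 + n)%N]/(1 + n)%N => G H.
rewrite -[G]submxK -[H]submxK.
set g := ulsubmx G; set g12 := ursubmx G; set g21 := dlsubmx G; set G22 := drsubmx G.
set h := ulsubmx H; set h12 := ursubmx H; set h21 := dlsubmx H; set H22 := drsubmx H.
move=> KG LH GH HG.
have [Z ghE] : rle (g *m h + g12 *m h21 - 1%:M) al.
  move: GH; rewrite mulmx_block [1%:M]scalar_mx_block opp_block_mx add_block_mx.
  by move=> /rle_block[].
(* Since g h + g12 h21 is 1 modulo [al], multiples of g12 h21 and [al] can be added to g to make it
   a unit modulo s. The shear [E] below performs the first addition; it preserves the kernel because
   L h21 lies in [al]. *)
have [|t [r' [W tE]]] := stable rs (y := g) (B := col_mx (g12 *m h21) al) (r := 0).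
  rewrite mul0r subr0; exists (row_mx h (row_mx 1%:M (- Z))).
  rewrite !mul_row_col mul1mx mulNmx -ghE [h *m g]mulmxC11.
  rewrite -[LHS](mxtrace1 R 1); congr (\tr _); move: (g *m h) (_ *m h21) 1%:M => x y z.
  by apply/matrixP => i j; rewrite !mxE; ring.
rewrite -[t]hsubmxK mul_row_col in tE.
set t1 := lsubmx t in tE; set t2 := rsubmx t in tE.
pose E : 'M[R]_(1 + n) := block_mx 1%:M 0 (h21 *m t1) 1%:M.
pose E' : 'M[R]_(1 + n) := block_mx 1%:M 0 (- (h21 *m t1)) 1%:M.
have EE' : E *m E' = 1%:M.
  rewrite mulmx_block !mulmx1 !mul1mx !mul0mx !mulmx0 !addr0 ?add0r subrr.
  by rewrite -scalar_mx_block.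
have E'E : E' *m E = 1%:M.
  rewrite mulmx_block !mulmx1 !mul1mx !mul0mx !mulmx0 !addr0 ?add0r addNr.
  by rewrite -scalar_mx_block.
have Lh : rle (L *m (h21 *m t1)) al.
  rewrite mulmxA; apply: rle_mul11.
  by move: LH; rewrite mulmx_block !mul0mx !add0r => /rle_block[].
have LE : rle (block_mx al 0 0 L *m E) (block_mx al 0 0 L).
  rewrite mulmx_block !mulmx1 !mul0mx !mulmx0 !addr0 !add0r; apply/rle_block.
  by split=> //; try exact: rle0; exact: rle_refl.
have LE' : rle (block_mx al 0 0 L *m E') (block_mx al 0 0 L).
  rewrite mulmx_block !mulmx1 !mul0mx !mulmx0 !addr0 !add0r; apply/rle_block.
  by split=> //; rewrite ?mulmxN; try exact: rle0; try exact: rleN; exact: rle_refl.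
set G' := block_mx g _ _ _ in KG LH GH HG; set H' := block_mx h _ _ _ in KG LH GH HG.
have GE : G' *m E = block_mx (g + g12 *m h21 *m t1) g12 (g21 + G22 *m h21 *m t1) G22.
  by rewrite mulmx_block !mulmx1 !mulmx0 !add0r !mulmxA.
have E'H : E' *m H' = block_mx h h12 (- (h21 *m t1) *m h + h21) (- (h21 *m t1) *m h12 + H22).
  by rewrite mulmx_block !mul1mx !mul0mx !addr0.
have KG' : rle (block_mx al 0 0 K *m (G' *m E)) (block_mx al 0 0 L).
  by rewrite mulmxA; apply: rle_trans LE; apply: rle_mulr.
have LH' : rle (block_mx al 0 0 L *m (E' *m H')) (block_mx al 0 0 K).
  by rewrite mulmxA; apply: rle_trans LH; apply: rle_mulr.
have GH' : rle (G' *m E *m (E' *m H') - 1%:M) (block_mx al 0 0 K).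
  by rewrite mulmxA -[G' *m E *m E']mulmxA EE' mulmx1.
have HG' : rle (E' *m H' *m (G' *m E) - 1%:M) (block_mx al 0 0 L).
  have -> : E' *m H' *m (G' *m E) - 1%:M = E' *m (H' *m G' - 1%:M) *m E.
    by rewrite mulmxBr mulmx1 mulmxBl E'E !mulmxA.
  by rewrite -mulmxA; apply: rle_mull; apply: rle_trans LE; apply: rle_mulr.
rewrite GE E'H in KG' LH' GH' HG'.
apply: (miso_schur KG' LH' GH' HG' (u := W)).
have {}tE : W *m (g + (t1 *m (g12 *m h21) + t2 *m al)) = (1 - r' * s)%:M.
  by rewrite tE [_ *m _ in RHS]mx11_scalar mxtrace_scalar -mx11_scalar.
have -> : (g + g12 *m h21 *m t1) *m W - 1%:M = - (r' *: s%:M) - t2 *m al *m W.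
  move: tE; rewrite scale_scalar_mx raddfB /= mulmxC11 [t1 *m _]mulmxC11 !mulmxDl.
  move: (g *m W) (_ *m t1 *m W) (t2 *m al *m W) (r' * s)%:M 1%:M => x y z v w e.
  have -> : x + y = w - v - z by rewrite -e; apply/matrixP => i j; rewrite !mxE; ring.
  by apply/matrixP => i j; rewrite !mxE; ring.
apply: rleB; first by apply: rleN; apply: rleZ.
by apply: rle_mul11; apply: rle_mul.
Qed.

End StableRange.

Lemma det_mx22 (R : comPzRingType) (A : 'M[R]_2) :
  \det A = A 0 0 * A 1 1 - A 0 1 * A 1 0.
Proof.
rewrite (expand_det_row _ 0) !big_ord_recl big_ord0 addr0 /cofactor !det_mx11 !mxE.
have -> : lift 0 0 = 1 :> 'I_2 by apply: val_inj.
have -> : lift 1 0 = 0 :> 'I_2 by apply: val_inj.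
by rewrite /= /bump /= !addn0 expr0 expr1; ring.
Qed.

(** * Unimodular rows *)

Section Unimodular.
Variable R : comPzRingType.
Hypothesis pp : forall a : R,
  exists e, e * e = e /\ forall x, a * x = 0 <-> e * x = x.
Hypothesis stable : almost_stable R.

(** On the factor cut out by w, a vanishes and the sum is s; on the other one w vanishes and a is
    regular. *)
Lemma regular_shift (a s w : R) : regular s -> w * w = w ->
  (forall x, a * x = 0 <-> w * x = x) -> regular (a + w * s).
Proof.
move=> rs ww aw x h.
have aw0 : a * w = 0 by apply/aw.
have wsx : w * x = 0.
  apply: rs; have : w * ((a + w * s) * x) = a * w * x + (w * w) * s * x by ring.
  by rewrite h mulr0 aw0 mul0r add0r ww => /esym <-; ring.
have /aw <- // : a * x = 0.
by move: h; rewrite mulrDl mulrAC wsx mul0r addr0.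
Qed.

Lemma content_shift m n (y z : 'M[R]_(m, n)) s x : content y x ->
  exists r, content (y + s *: z) (x - r * s).
Proof.
apply: (contentE (Q := fun x => exists r, content (y + s *: z) (x - r * s))).
- by exists 0; rewrite mul0r subr0; apply: content0.
- move=> x1 x2 [r1 h1] [r2 h2]; exists (r1 + r2).
  have -> : x1 + x2 - (r1 + r2) * s = (x1 - r1 * s) + (x2 - r2 * s) by ring.
  exact: contentD.
- move=> a x1 [r1 h1]; exists (a * r1).
  have -> : a * x1 - a * r1 * s = a * (x1 - r1 * s) by ring.
  exact: contentM.
move=> i j; exists (- z i j).
have -> : y i j - - z i j * s = (y + s *: z) i j by rewrite !mxE; ring.
exact: content_entry.
Qed.

(* Pick p, q in the row space whose exterior product is generically nonzero,  *)
(* and y = p' + s w q which is unimodular modulo some regular s in the        *)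
(* content of p.  The 2x2 minors of (p, y) are those of (p, y + t p); they    *)
(* contain a regular element s', so that it suffices to choose t modulo s'.   *)
Lemma unimodular_row k n (B : 'M[R]_(k, n)) :
  content B 1 -> faithful (minor2 B) -> exists t : 'rV_k, content (t *m B) 1.
Proof.
move=> B1 /(faithful_regular pp)[ep [epM]].
set s := \sum_i _ => rs.
pose p := \sum_i ep i *: row i.1.1 B; pose q := \sum_i ep i *: row i.1.2 B.
have epp i j : ep i * p 0 j = ep i * B i.1.1 j.
  rewrite summxE mulr_sumr (bigD1 i) //= big1 => [|l li].
    by rewrite addr0 !mxE mulrA epM eqxx mul1r.
  by rewrite !mxE mulrA epM eq_sym (negPf li) !mul0r.
have epq i j : ep i * q 0 j = ep i * B i.1.2 j.
  rewrite summxE mulr_sumr (bigD1 i) //= big1 => [|l li].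
    by rewrite addr0 !mxE mulrA epM eqxx mul1r.
  by rewrite !mxE mulrA epM eq_sym (negPf li) !mul0r.
have pB : rle p B by apply: rle_sum => i; apply: rleZ; rewrite rowE; apply: rle_mul.
have qB : rle q B by apply: rle_sum => i; apply: rleZ; rewrite rowE; apply: rle_mul.
(* A combination of the 2x2 minors of (p, y): linear in y, zero at p, equal to s at q, and with
   values in the content of y. *)
pose mu (y : 'rV[R]_n) :=
  \sum_i ep i * (p 0 i.2.1 * y 0 i.2.2 - p 0 i.2.2 * y 0 i.2.1).
have muq : mu q = s.
  apply: eq_bigr => i _.
  have -> x y z t : ep i * (x * y - z * t) = (ep i * x) * y - (ep i * z) * t by ring.
  rewrite !epp.
  have -> x y z t : (ep i * x) * y - (ep i * z) * t = x * (ep i * y) - z * (ep i * t) by ring.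
  by rewrite !epq /minor2; ring.
have muD y z a : mu (y + a *: z) = mu y + a * mu z.
  rewrite mulr_sumr -big_split; apply: eq_bigr => i _; rewrite !mxE /=; ring.
have mup : mu p = 0.
  by rewrite /mu big1 // => i _; rewrite [X in X - _]mulrC subrr mulr0.
have cmul y : content y (mu y).
  apply: content_sum => i _; apply: contentM.
  have -> (x z t u : R) : x * z - t * u = x * z + (- t) * u by ring.
  by apply: contentD; apply: contentM; apply: content_entry.
have cp : content p s.
  rewrite -muq; apply: content_sum => i _; apply: contentM.
  have -> (x z t u : R) : x * z - t * u = z * x + (- u) * t by ring.
  by apply: contentD; apply: contentM; apply: content_entry.
have [|t0 [r0]] := stable rs (y := 0) (B := B) (r := 0).
  by rewrite mul0r subr0; apply: content_dsub.
rewrite add0r; set y0 := t0 *m B => y0c.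
have [w [ww wP]] := pp (mu y0).
pose y := y0 + s *: (w *: q).
have [r1 yc] := content_shift (w *: q) s y0c.
have rs' : regular (mu y).
  have -> : mu y = mu y0 + w * (s * s).
    by rewrite /y scalerA muD muq; ring.
  by apply: regular_shift => // x; rewrite -mulrA => /rs/rs.
have [|t [r' zc]] := stable rs' (y := y) (B := p) (r := 0).
  rewrite mul0r subr0.
  have -> : 1 = (1 - r0 * s - r1 * s) + (r0 + r1) * s by ring.
  by apply: contentD; [apply: content_usub|apply/contentM/content_dsub].
have zE : t *m p = t 0 0 *: p by rewrite [t]mx11_scalar mul_scalar_mx !mxE eqxx.
have [v vE] : rle (y + t *m p) B.
  apply: rleD; last exact: rle_mull.
  by apply: rleD; [apply: rle_mul|do 2!apply: rleZ].
exists v; rewrite -vE.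
have -> : 1 = (1 - r' * mu y) + r' * mu (y + t *m p).
  by rewrite zE (muD y p) mup; ring.
by apply: contentD => //; apply: contentM.
Qed.

Lemma content11 (x : 'M[R]_1) r : content x r -> exists c, r = c * x 0 0.
Proof.
move=> [W ->]; exists (W 0 0).
by rewrite [X in \tr X]mx11_scalar mxtrace_scalar mulr1n mxE big_ord1.
Qed.

(* Make the first entry a regular; R/Ra has stable range 1, hence the second   *)
(* entry can be made a unit modulo a; a matrix of SL_2 then yields the entry 1. *)
Lemma unimodular_completion k (z : 'rV[R]_(1 + (1 + k))) : content z 1 ->
  exists A : 'M[R]_(1 + (1 + k)), \det A = 1 /\ z *m A = row_mx 1%:M 0.
Proof.
pose P (z : 'rV[R]_(1 + (1 + k))) := 
  exists A : 'M[R]_(1 + (1 + k)), \det A = 1 /\ z *m A = row_mx 1%:M 0.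
have Pmul u (A : 'M_(1 + (1 + k))) : \det A = 1 -> P (u *m A) -> P u.
  move=> dA [B [dB e]]; exists (A *m B); rewrite det_mulmx dA dB mulr1.
  by rewrite mulmxA.
have contmul u (A : 'M[R]_(1 + (1 + k))) : \det A = 1 -> content u 1 -> content (u *m A) 1.
  move=> /det1_inv[AA' _]; apply: content_sub => i j.
  by rewrite -{2}[u]mulmx1 -AA' mulmxA; apply: content_mulr.
rewrite -/(P z).
rewrite -[z]hsubmxK; move: (lsubmx z) (rsubmx z) => a b zc.
have [ep [_ [_ _ _ _ sx]]] := orthogonal_idempotents pp (b 0).
set s := \sum_i _ in sx.
have [e [ee eP]] := pp (a 0 0).
(* The shear adds e s to the first entry. Where that entry vanishes, the others generate the unit
   ideal, so their combination s is regular. *)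
pose A1 : 'M[R]_(1 + (1 + k)) := block_mx 1%:M 0 (\col_i (e * ep i)) 1%:M.
have dA1 : \det A1 = 1 by rewrite det_lblock !det1 mulr1.
apply: (Pmul _ _ dA1).
have {zc} := contmul _ _ _ dA1 zc.
rewrite mul_row_block !mulmx1 mulmx0 add0r.
have -> : b *m (\col_i (e * ep i)) = (e * s)%:M.
  rewrite [LHS]mx11_scalar; congr _%:M.
  by rewrite mxE mulr_sumr; apply: eq_bigr => i _; rewrite mxE; ring.
set a' := a + _ => zc.
have a'E : a' 0 0 = a 0 0 + e * s by rewrite !mxE eqxx.
have ae : a 0 0 * e = 0 by apply/eP.
have ra : regular (a' 0 0).
  move=> x; rewrite a'E => h.
  have ax0 : a 0 0 * x = 0.
    have : (1 - e) * ((a 0 0 + e * s) * x) =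
      a 0 0 * x - a 0 0 * e * x + (e - e * e) * s * x by ring.
    by rewrite h mulr0 ae ee subrr !mul0r subr0 addr0.
  have sx0 : s * x = 0.
    have /eP ex := ax0; rewrite -ex.
    have <- : (a 0 0 + e * s) * x = s * (e * x) by rewrite mulrDl ax0 add0r; ring.
    by [].
  have bx := sx _ sx0.
  rewrite -[x]mul1r.
  apply: (contentE (Q := fun y => y * x = 0)) zc.
  - by rewrite mul0r.
  - by move=> u v hu hv; rewrite mulrDl hu hv addr0.
  - by move=> u v hv; rewrite -mulrA hv mulr0.
  move=> i j; rewrite ord1; case: (split_ordP j) => j' ->.
    by rewrite row_mxEl ord1 a'E.
  by rewrite row_mxEr.
move: a' zc ra {eP ae a'E} => {}a zc ra.
rewrite -[b]hsubmxK in zc *; move: (lsubmx b) (rsubmx b) zc => b1 b2 zc.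
have [r zc'] : exists r, content (col_mx b1 b2^T) (1 - r * a 0 0).
  apply: (contentE (Q := fun y => exists r, content (col_mx b1 b2^T) (y - r * a 0 0))) zc.
  - by exists 0; rewrite mul0r subr0; apply: content0.
  - move=> x1 x2 [r1 h1] [r2 h2]; exists (r1 + r2).
    have -> : x1 + x2 - (r1 + r2) * a 0 0 = (x1 - r1 * a 0 0) + (x2 - r2 * a 0 0) by ring.
    exact: contentD.
  - move=> c x1 [r1 h1]; exists (c * r1).
    have -> : c * x1 - c * r1 * a 0 0 = c * (x1 - r1 * a 0 0) by ring.
    exact: contentM.
  move=> i j; rewrite ord1; case: (split_ordP j) => j' ->.
    by exists 1; rewrite row_mxEl ord1 mul1r subrr; apply: content0.
  exists 0; rewrite mul0r subr0 row_mxEr; case: (split_ordP j') => l ->.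
    by rewrite row_mxEl ord1; apply: content_usub; apply: content_entry.
  rewrite row_mxEr; apply: content_dsub.
  have -> : b2 0 l = b2^T l 0 by rewrite mxE.
  exact: content_entry.
have [t [r' tc]] := stable ra zc'.
pose A2 : 'M[R]_(1 + (1 + k)) := block_mx 1%:M 0 0 (block_mx 1%:M 0 t^T 1%:M).
have dA2 : \det A2 = 1 by rewrite det_lblock det_lblock !det1 !mulr1.
apply: (Pmul _ _ dA2).
rewrite mul_row_block !mulmx0 addr0 add0r mul_row_block !mulmx0 !mulmx1 add0r.
have -> : b2 *m t^T = t *m b2^T.
  by rewrite -[RHS]trmxK trmx_mul trmxK [X in _ = X^T]mx11_scalar tr_scalar_mx -mx11_scalar.
move: (b1 + _) tc => {zc zc'}b1 /content11[x xE].
pose S : 'M[R]_(1 + 1) := block_mx r'%:M (- b1) x%:M a.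
have dS : \det S = 1.
  have e0 : lshift 1 (0 : 'I_1) = 0 by apply: val_inj.
  have e1 : rshift 1 (0 : 'I_1) = 1 by apply: val_inj.
  have := block_mxEul r'%:M (- b1) x%:M a 0 0; have := block_mxEur r'%:M (- b1) x%:M a 0 0.
  have := block_mxEdl r'%:M (- b1) x%:M a 0 0; have := block_mxEdr r'%:M (- b1) x%:M a 0 0.
  rewrite !e0 !e1 det_mx22 -/S => -> -> -> ->; rewrite !mxE !mulr1n.
  by rewrite mulNr opprK [b1 _ _ * _]mulrC -xE addrC subrK.
pose A3 : 'M[R]_(1 + 1 + k) := block_mx S 0 0 1%:M.
apply: (Pmul _ (A3 : 'M_(1 + (1 + k)))).
  by have := det_ublock S 0 (1%:M : 'M_k); rewrite dS det1 mulr1.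
have -> : row_mx a (row_mx b1 b2) = row_mx (row_mx a b1) b2 :> 'rV_(1 + 1 + k).
  by rewrite row_mxA castmx_id.
have -> : row_mx (row_mx a b1) b2 *m A3 = row_mx (row_mx 1%:M (0 : 'M_1)) b2.
  rewrite mul_row_block !mulmx0 mulmx1 addr0 add0r mul_row_block mulmxN.
  rewrite [b1 *m a]mulmxC11 addNr !mul_mx_scalar; congr (row_mx (row_mx _ _) _).
  rewrite [a]mx11_scalar [b1]mx11_scalar !scale_scalar_mx -raddfD /= -xE.
  by rewrite addrC subrK.
have -> : row_mx (row_mx 1%:M (0 : 'M_1)) b2 = row_mx 1%:M (row_mx (0 : 'M_1) b2) :> 'rV_(1 + (1 + k)).
  by rewrite row_mxA castmx_id.
exists (block_mx 1%:M (- row_mx (0 : 'M_1) b2) 0 1%:M); rewrite det_ublock !det1 mulr1.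
by rewrite mul_row_block !mulmx0 !mulmx1 mul1mx addr0 addNr.
Qed.

End Unimodular.

(** * Rank at least two *)

Section Splitting.
Variable R : comPzRingType.
Hypothesis pp : forall a : R,
  exists e, e * e = e /\ forall x, a * x = 0 <-> e * x = x.
Hypothesis arith : forall a b : R,
  exists t c d, t * b = c * a /\ (1 - t) * a = d * b.
Hypothesis stable : almost_stable R.

Lemma minor2_mull m k n (X : 'M[R]_(m, k)) (C : 'M[R]_(k, n)) x :
  (forall i, minor2 C i * x = 0) -> forall i, minor2 (X *m C) i * x = 0.
Proof.
move=> h [[i i'] [j j']]; rewrite /minor2 /= !mxE.
have -> : (\sum_a X i a * C a j) * (\sum_b X i' b * C b j') -
   (\sum_a X i a * C a j') * (\sum_b X i' b * C b j) =
   \sum_a \sum_b X i a * X i' b * minor2 C ((a, b), (j, j')).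
  rewrite !mulr_suml -sumrB; apply: eq_bigr => a _.
  rewrite !mulr_sumr -sumrB; apply: eq_bigr => b _.
  by rewrite /minor2 /=; ring.
rewrite mulr_suml big1 // => a _; rewrite mulr_suml big1 // => b _.
by rewrite -mulrA h mulr0.
Qed.

Lemma faithful_minor2 m n (K : 'M[R]_(m, n)) :
  faithful (minor2 K) -> faithful (fun p : 'I_m * 'I_n => K p.1 p.2).
Proof.
move=> fK x Kx; apply: fK => -[[i i'] [j j']]; rewrite /minor2 /=.
by rewrite mulrBl -!mulrA (Kx (i', j')) (Kx (i', j)) !mulr0 subrr.
Qed.

(** The rows of [C] span (K : I) and satisfy the hypotheses of [unimodular_row]: the minors of K are
    combinations of theirs. Once a unimodular vector of (K : I) is moved to e_1, I e_1 lies in K A;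
    it splits off because the first column of K A has entries in I. *)
Lemma split_unimodular m k (K : 'M[R]_(m, 1 + (1 + k))) : faithful (minor2 K) ->
  exists (L : 'M[R]_(m, 1 + k)), sl_equiv K (block_mx (mxvec K)^T 0 0 L).
Proof.
move=> fK.
have [l [C [s [Q [X [rs sC [KX _] KC C1]]]]]] := unit_content pp arith (faithful_minor2 fK).
have fC : faithful (minor2 C).
  by move=> x Cx; apply: fK; rewrite KX; apply: minor2_mull.
have [t tC] := unimodular_row pp stable C1 fC.
have [A [dA tCA]] := unimodular_completion pp stable tC.
have Ke x : content K x -> rle (x *: row_mx 1%:M 0) (K *m A).
  apply: (contentE (Q := fun x => rle (x *: row_mx 1%:M 0) (K *m A))).
  - by rewrite scale0r; apply: rle0.
  - by move=> y z hy hz; rewrite scalerDl; apply: rleD.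
  - by move=> a y hy; rewrite -scalerA; apply: rleZ.
  move=> i j; rewrite -tCA -mulmxA scalemxAr scalemxAl.
  by apply: rle_mull; apply: rle_mulr.
have KA : K *m A = row_mx (lsubmx (K *m A)) (rsubmx (K *m A)) by rewrite hsubmxK.
set b := lsubmx _ in KA; set L := rsubmx _ in KA.
exists L; exists A; split=> //; rewrite KA.
  apply/rle_row_block; split; last by rewrite /L; apply: rle_refl.
  by apply: rle_content => i; rewrite mxE; apply: content_mulr.
have rb q (y : 'M_(q, 1)) : (forall i, content K (y i 0)) -> rle (row_mx y 0) (row_mx b L).
  move=> yK; rewrite -KA; apply: rle_rows => i.
  have -> : row i (row_mx y (0 : 'M_(q, 1 + k))) = y i 0 *: row_mx 1%:M 0.
    rewrite row_row_mx scale_row_mx row0 scaler0; congr row_mx.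
    by rewrite [row i y]mx11_scalar mxE scale_scalar_mx mulr1.
  exact: Ke.
apply: rle_col; first by apply: rb => i; apply: content_mxvec.
have -> : row_mx 0 L = row_mx b L - row_mx b 0.
  by rewrite opp_row_mx add_row_mx subrr oppr0 addr0.
apply: rleB; first exact: rle_refl.
by apply: rb => i; rewrite mxE; apply: content_mulr.
Qed.

Hypothesis red : reduced R.

Lemma det_mul_ltn p q (X : 'M[R]_(q, p)) (Y : 'M[R]_(p, q)) :
  (p < q)%N -> \det (X *m Y) = 0.
Proof.
move=> pq; have e : (q = 1 + (q - p).-1 + p)%N by rewrite add1n prednK ?subn_gt0 // subnK // ltnW.
move: X Y; move: {pq}((q - p).-1) e => r e; subst q => X Y.
have -> : X *m Y = row_mx 0 X *m col_mx (0 : 'M_(1 + r, 1 + r + p)) Y.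
  by rewrite mul_row_col mulmx0 add0r.
rewrite det_mulmx (expand_det_col _ (lshift p (lshift r ord0))) big1 ?mul0r // => i _.
by rewrite (row_mxEl (0 : 'M_(1 + r + p, 1 + r))) mxE mul0r.
Qed.

(** For p = (i, j), vanishing minors give K i j K = (column j)(row i); this is used on the component
    [ep p] and summed over p. *)
Lemma rank_le1_factor m n (K : 'M[R]_(m, n)) : rank_le1 K ->
  exists (c : 'cV[R]_m) (r : 'rV[R]_n) s, s *: K = c *m r /\
    forall x, s * x = 0 -> forall i j, K i j * x = 0.
Proof.
move=> K1; have [ep [_ [_ epM _ _ sx]]] :=
  orthogonal_idempotents_fin pp (fun p : 'I_m * 'I_n => K p.1 p.2).
exists (\col_k \sum_p ep p * K k p.2), (\row_l \sum_p ep p * K p.1 l),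
  (\sum_p ep p * K p.1 p.2); split; last first.
  by move=> x /sx h i j; apply: (h (i, j)).
apply/matrixP => k l; rewrite !mxE big_ord1 !mxE mulr_suml mulr_suml.
apply: eq_bigr => p _; rewrite mulr_sumr (bigD1 p) //= big1 => [|q qp]; last first.
  have -> (x y z t : R) : x * z * (y * t) = x * y * (z * t) by ring.
  by rewrite epM eq_sym (negPf qp) !mul0r.
have -> (x z t : R) : x * z * (x * t) = x * x * (z * t) by ring.
by rewrite epM eqxx mul1r addr0 -mulrA; congr (_ * _); rewrite mulrC K1 mulrC.
Qed.

(* [K] and [L] present the same module: diag(L, 1) is a multiple of diag(1, K) *)
(* (Fitting), so that the minors of [L] are bounded in terms of those of [K].  *)
Lemma rank_le1_miso m p n (K : 'M[R]_(m, n)) (L : 'M[R]_(p, n)) :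
  miso K L -> rank_le1 K -> rank_le1 L.
Proof.
move=> KL /rank_le1_factor[c [r [s [sK sx]]]] i i' j j'.
apply/eqP; rewrite -subr_eq0; apply/eqP; set d := _ - _.
have dL : content L d.
  have -> : d = L i j * L i' j' + (- L i j') * L i' j by rewrite /d; ring.
  by apply: contentD; apply: contentM; apply: content_entry.
(* Then d is killed by all entries of K, but belongs to their ideal: its square is 0. *)
suff sd0 : s * d = 0.
  apply: (@red _ 2); rewrite expr2.
  have := content_miso (miso_sym KL) dL.
  apply: (contentE (Q := fun y => d * y = 0)) => [|x y hx hy|a x hx|k l].
  - by rewrite mulr0.
  - by rewrite mulrDr hx hy addr0.
  - by rewrite mulrCA hx mulr0.
  - by rewrite mulrC; apply: sx.
have [G [H [[X KG] [Y LH] [Z GH] _]]] := KL.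
pose P : 'M[R]_(2, p) := \matrix_(a, b) (b == if a == 0 then i else i')%:R.
pose N : 'M[R]_(n, 2) := \matrix_(b, a) (b == if a == 0 then j else j')%:R.
have PLN a b : (P *m L *m N) a b = L (if a == 0 then i else i') (if b == 0 then j else j').
  rewrite mxE (bigD1 (if b == 0 then j else j')) //= big1 => [|l lj]; last first.
    by rewrite [N _ _]mxE (negPf lj) mulr0.
  rewrite [N _ _]mxE eqxx mulr1 addr0 mxE (bigD1 (if a == 0 then i else i')) //=.
  rewrite big1 => [|l li]; last by rewrite [P _ _]mxE (negPf li) mul0r.
  by rewrite [P _ _]mxE eqxx mul1r addr0.
pose D := block_mx (P *m L *m N) 0 0 (1%:M : 'M[R]_n).
have dD : \det D = d.
  by rewrite det_ublock det1 mulr1 det_mx22 !PLN.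
have LK : block_mx L 0 0 (1%:M : 'M_n) =
    block_mx L Y (- G) (- Z) *m block_mx 1%:M 0 0 K *m
    (block_mx 1%:M (- H) 0 1%:M *m block_mx 1%:M 0 G 1%:M).
  rewrite !mulmx_block !mulmx0 !mul0mx !mulmx1 !addr0 !add0r ?mul1mx.
  rewrite !mulNmx -LH -GH; congr block_mx.
  - by rewrite mulmxBr mulmx1 mulmxA subrK.
  - by rewrite mulmx1 mulmxN addNr.
  - by rewrite mulmxBr mulmxBl mulmx1 mul1mx mulmxA opprB subrr.
  - by rewrite mulmx1 mulmxN opprK opprB addrC subrK.
(* s diag(1, K) factors through R^(n+1), while [D] has size n + 2 and is a compression of diag(L,
   1). So det(s D) = s^(n+2) d is 0. *)
have sDE : s *: block_mx 1%:M 0 0 K =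
    block_mx (0 : 'M_(n, 1)) 1%:M c 0 *m block_mx (0 : 'M_(1, n)) r s%:M 0.
  rewrite mulmx_block !mulmx0 !mul0mx mul1mx !addr0 !add0r -sK scale_block_mx.
  by rewrite !scaler0 scale_scalar_mx mulr1.
have DLE : D = block_mx P 0 0 1%:M *m block_mx L 0 0 (1%:M : 'M_n) *m block_mx N 0 0 1%:M.
  by rewrite !mulmx_block !mulmx0 !mul0mx !mulmx1 !addr0 !add0r ?mul1mx mul0mx.
have : \det (s *: D) = 0.
  set V := _ *m block_mx 1%:M 0 G 1%:M in LK.
  set Bc := block_mx 0 1%:M c 0 in sDE; set Bd := block_mx 0 r s%:M 0 in sDE.
  have -> : s *: D = block_mx P 0 0 1%:M *m block_mx L Y (- G) (- Z) *m Bc *m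
      (Bd *m V *m block_mx N 0 0 1%:M).
    by rewrite DLE LK !mulmxA -[_ *m Bc *m Bd]mulmxA -sDE -!scalemxAr -!scalemxAl.
  exact: det_mul_ltn.
rewrite detZ dD => sd; apply: (@red _ n.+2).
by rewrite exprMn [d ^+ _]exprS mulrA sd mul0r.
Qed.

End Splitting.

(** * Rank one *)

(** The bordered matrix [E] has determinant det(s + c r), and a factor of determinant s makes it
    block triangular: the matrix determinant lemma without division by s. *)
Lemma det_add_rank1 (R : comPzRingType) n (s : R) (c : 'cV[R]_n) (r : 'rV[R]_n) :
  s * \det (s%:M + c *m r) = s ^+ n * (s + (r *m c) 0 0).
Proof.
pose E : 'M[R]_(n + 1) := block_mx s%:M c (- r) 1%:M.
have e1 : \det E = \det (s%:M + c *m r).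
  have : \det (E *m block_mx 1%:M 0 r 1%:M) = \det (s%:M + c *m r).
    rewrite mulmx_block !mulmx1 !mulmx0 !mul1mx !add0r addNr.
    by rewrite det_ublock det1 mulr1.
  by rewrite det_mulmx det_lblock !det1 !mulr1.
have : \det (E *m block_mx 1%:M (- c) 0 s%:M) = s ^+ n * (s + (r *m c) 0 0).
  rewrite mulmx_block !mulmx1 !mulmx0 !mul1mx !addr0.
  rewrite mul_scalar_mx mul_mx_scalar scalerN addNr mulNmx mulmxN opprK.
  by rewrite det_lblock det_scalar det_mx11 !mxE mulr1n addrC.
by rewrite det_mulmx det_ublock det1 det_scalar1 mul1r e1 mulrC.
Qed.

Section RankOne.
Variable R : comNzRingType.

Lemma monicI (p : {poly R}) q q' : p \is monic -> p * q = p * q' -> q = q'.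
Proof.
move=> mp e; apply/eqP; rewrite -subr_eq0; apply/eqP.
have : p * (q - q') = 0 by rewrite mulrBr e subrr.
by move=> /eqP; rewrite (mulrI_eq0 _ (monic_lreg mp)) => /eqP.
Qed.

(** A and B are the values at 0 of X + A and X + B, whose determinants are monic and hence can be
    cancelled in R[X]. *)
Lemma adj_mulmx n (A B : 'M[R]_n) : \adj (A *m B) = \adj B *m \adj A.
Proof.
pose ev : {rmorphism {poly R} -> R} := horner_eval 0.
have lift (C : 'M[R]_n) : map_mx ev (char_poly_mx (- C)) = C.
  apply/matrixP => i j; rewrite !mxE /= /horner_eval !hornerE.
  by rewrite hornerMn hornerX mul0rn sub0r opprK.
rewrite -[A]lift -[B]lift -map_mxM -!map_mx_adj -map_mxM; congr map_mx.
set A' := char_poly_mx _; set B' := char_poly_mx _.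
have mAB : \det (A' *m B') \is monic.
  by rewrite det_mulmx monicMl ?char_poly_monic.
apply/matrixP => i j; apply: (monicI mAB).
have : (\adj (A' *m B') *m (A' *m B')) *m (\adj B' *m \adj A') =
       \adj (A' *m B') *m (A' *m (B' *m \adj B') *m \adj A') by rewrite !mulmxA.
rewrite mul_adj_mx mul_mx_adj mul_mx_scalar -scalemxAl mul_mx_adj.
rewrite mul_scalar_mx scale_scalar_mx mul_mx_scalar => /matrixP/(_ i j).
by rewrite !mxE det_mulmx mulrC [X in _ = X -> _]mulrC => ->; rewrite mulrC [\det A' * _]mulrC.
Qed.

Hypothesis pp : forall a : R,
  exists e, e * e = e /\ forall x, a * x = 0 <-> e * x = x.

Lemma rank_le1_mul m n (K : 'M[R]_(m, n)) (W : 'M[R]_(n, m)) :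
  rank_le1 K -> K *m W *m K = \tr (W *m K) *: K.
Proof.
move=> K1; apply/matrixP => i j; rewrite !mxE /mxtrace mulr_suml.
under eq_bigr do rewrite mxE mulr_suml.
under [RHS]eq_bigr do rewrite mxE mulr_suml.
rewrite exchange_big; apply: eq_bigr => k _; apply: eq_bigr => l _.
by rewrite mulrAC K1; ring.
Qed.

Lemma rank1_idempotent n (P : 'M[R]_n) : rank_le1 P -> \tr P = 1 -> P *m P = P.
Proof.
by move=> P1 tP; have := rank_le1_mul 1%:M P1; rewrite mulmx1 mul1mx tP scale1r.
Qed.

(* Generically P = c r / s, so that det(1 - P + X P) = X.                      *)
Lemma rank1_det n (P : 'M[R]_n) : rank_le1 P -> \tr P = 1 ->
  (forall u, \det (1%:M - P + u *: P) = u) /\ \adj (1%:M - P) = P.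
Proof.
move=> P1 tP; have PP := rank1_idempotent P1 tP.
have [c [r [s [sP sx]]]] := rank_le1_factor pp P1.
have rs : regular s.
  move=> x /sx Px; rewrite -[x]mul1r -tP /mxtrace mulr_suml big1 // => i _.
have rc : (r *m c) 0 0 = s.
  have := congr1 mxtrace sP; rewrite mxtraceZ tP mulr1 mxtrace_mulC => ->.
  by rewrite [in RHS](mx11_scalar (r *m c)) mxtrace_scalar.
pose Q := map_mx polyC P.
pose N u := 1%:M - Q + u *: Q.
have QQ : Q *m Q = Q by rewrite -map_mxM PP.
have dN : \det (N 'X) = 'X.
  have sI (q q' : {poly R}) : s%:P * q = s%:P * q' -> q = q'.
    move=> e; apply/polyP => i; apply/eqP; rewrite -subr_eq0; apply/eqP/rs.
    by rewrite mulrBr -!coefCM e subrr.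
  have sIn k (q q' : {poly R}) : s%:P ^+ k * q = s%:P ^+ k * q' -> q = q'.
    by elim: k q q' => [|k IH] q q'; rewrite ?mul1r // exprS -!mulrA => /sI/IH.
  apply: (@sIn n); rewrite -detZ; apply: sI.
  have -> : s%:P *: N 'X = s%:P%:M + (('X - 1) *: map_mx polyC c) *m map_mx polyC r.
    rewrite -scalemxAl -map_mxM -sP map_mxZ -/Q.
    rewrite /N scalerDr scalerBr scale_scalar_mx mulr1 -addrA; congr (_ + _).
    by rewrite !scalerA -scaleNr -scalerDl; congr (_ *: _); ring.
  rewrite det_add_rank1 -scalemxAr -map_mxM mxE [_ 0 0]mxE rc; ring.
split=> [u|].
  have := congr1 (fun p => p.[u]) dN; rewrite hornerX => {2}<-.
  rewrite -[RHS]/(horner_eval u _) -det_map_mx; congr determinant.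
  by apply/matrixP => i j; rewrite !mxE /= /horner_eval !hornerE hornerMn hornerC.
(* As det N(X) = X is regular, this determines adj N(X); its value at 0 is P. *)
have NM : N 'X *m (Q + 'X *: (1%:M - Q)) = 'X%:M.
  rewrite mulmxDl !mulmxDr -!scalemxAl -!scalemxAr !mulmxBl !mulmxBr !mulmx1 !mul1mx QQ.
  by rewrite !subrr !scaler0 !(add0r, addr0, subr0) -scalerDr subrK scale_scalar_mx mulr1.
have aN : \adj (N 'X) = Q + 'X *: (1%:M - Q).
  have := congr1 (mulmx (\adj (N 'X))) NM.
  rewrite mulmxA mul_adj_mx dN mul_scalar_mx mul_mx_scalar => /matrixP e.
  apply/matrixP => i j; apply: (monicI (monicX R)).
  have : forall M : 'M[{poly R}]_n, ('X *: M) i j = 'X * M i j by move=> M; rewrite mxE.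
  by move=> h; rewrite -!h e.
pose ev : {rmorphism {poly R} -> R} := horner_eval 0.
have := congr1 (map_mx ev) aN; rewrite map_mx_adj.
have -> : map_mx ev (N 'X) = 1%:M - P.
  by apply/matrixP => i j; rewrite !mxE /= /horner_eval !hornerE hornerMn hornerC. 
move=> ->.
by apply/matrixP => i j; rewrite !mxE /= /horner_eval !hornerE.
Qed.

Hypothesis arith : forall a b : R,
  exists t c d, t * b = c * a /\ (1 - t) * a = d * b.

(* The rank one summand (K : I) R^n, as the image of an idempotent matrix,     *)
(* where I is the content of K; the last property says that I (K : I) <= K.    *)
Lemma rank1_projector m n (K : 'M[R]_(m, n)) :
  rank_le1 K -> faithful (fun p : 'I_m * 'I_n => K p.1 p.2) ->
  exists P : 'M[R]_n, [/\ rank_le1 P, \tr P = 1, K *m P = K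
    & forall q (Y : 'M[R]_(q, n)), (forall i j, content K (Y i j)) -> rle (Y *m P) K].
Proof.
move=> K1 fK.
have [k [C [s [Q [X [rs sC [KX XK] KC [W WC]]]]]]] := unit_content pp arith fK.
have C1 : rank_le1 C.
  move=> i i' j j'; apply/eqP; rewrite -subr_eq0; apply/eqP/rs/rs.
  have CE a b : s * C a b = \sum_l Q a l * K l b by have := congr1 (fun M : 'M_(k, n) => M a b) sC; rewrite !mxE.
  have -> : s * (s * (C i j * C i' j' - C i j' * C i' j)) =
    (s * C i j) * (s * C i' j') - (s * C i j') * (s * C i' j) by ring.
  rewrite !CE !mulr_suml -sumrB big1 // => a _; rewrite !mulr_sumr -sumrB big1 // => b _.
  have -> (x y z t u v : R) : x * y * (z * t) - x * u * (z * v) = x * z * (y * t - u * v) by ring.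
  by rewrite K1 subrr mulr0.
have CP : C *m (W *m C) = C by rewrite mulmxA rank_le1_mul // -WC scale1r.
exists (W *m C); split=> //.
- move=> i i' j j'; apply/eqP; rewrite -subr_eq0 !mxE; apply/eqP.
  rewrite !mulr_suml -sumrB big1 // => a _; rewrite !mulr_sumr -sumrB big1 // => b _.
  have -> (x y z t u v : R) : x * y * (z * t) - x * u * (z * v) = x * z * (y * t - u * v) by ring.
  by rewrite C1 subrr mulr0.
- by rewrite KX -mulmxA CP.
move=> q Y YK; rewrite mulmxA.
have : forall i j, content K ((Y *m W) i j).
  by move=> i j; rewrite mxE; apply: content_sum => l _; rewrite mulrC; apply: contentM.
move: (Y *m W) => {YK}Y YK; apply: rle_rows => i.
rewrite row_mul mulmx_sum_row; apply: rle_sum => j; rewrite mxE.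
move: (YK i j); apply: (contentE (Q := fun x => rle (x *: row j C) K)).
- by rewrite scale0r; apply: rle0.
- by move=> y z hy hz; rewrite scalerDl; apply: rleD.
- by move=> a y hy; rewrite -scalerA; apply: rleZ.
by move=> a b; rewrite -linearZ /= rowE; apply: rle_mull.
Qed.

(* J = im P and J' = im P' have complements N, N' isomorphic through X and Y,  *)
(* hence are isomorphic: taking adjugates amounts to comparing determinants.   *)
Lemma rank1_sl_equiv m p n (K : 'M[R]_(m, n)) (L : 'M[R]_(p, n)) :
  miso K L -> reduced R -> rank_le1 K ->
  faithful (fun p : 'I_m * 'I_n => K p.1 p.2) -> sl_equiv K L.
Proof.
move=> KL red K1 fK.
have L1 := rank_le1_miso pp red KL K1.
have cKL := content_miso KL; have cLK := content_miso (miso_sym KL).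
have fL : faithful (fun p : 'I_p * 'I_n => L p.1 p.2).
  move=> x Lx; apply: fK => -[i j] /=.
  have := cKL _ (content_entry K i j).
  apply: (contentE (Q := fun y => y * x = 0)) => [|y z hy hz|a y hy|k l].
  - by rewrite mul0r.
  - by rewrite mulrDl hy hz addr0.
  - by rewrite -mulrA hy mulr0.
  - exact: (Lx (k, l)).
have [P [P1 tP KP Pb]] := rank1_projector K1 fK.
have [P' [P'1 tP' LP' P'b]] := rank1_projector L1 fL.
have PP := rank1_idempotent P1 tP; have PP' := rank1_idempotent P'1 tP'.
have [_ aN] := rank1_det P1 tP; have [dN' aN'] := rank1_det P'1 tP'.
have [G [H [KG LH GH HG]]] := KL.
pose N := 1%:M - P; pose N' := 1%:M - P'; rewrite -/N in aN; rewrite -/N' in aN' dN'.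
have PN : P *m N = 0 by rewrite mulmxBr mulmx1 PP subrr.
have PN' : P' *m N' = 0 by rewrite mulmxBr mulmx1 PP' subrr.
have NP' : N' *m P' = 0 by rewrite mulmxBl mul1mx PP' subrr.
have NP : N *m P = 0 by rewrite mulmxBl mul1mx PP subrr.
have NN : N *m N = N by rewrite {1}/N mulmxBl mul1mx PN subr0.
have NN' : N' *m N' = N' by rewrite {1}/N' mulmxBl mul1mx PN' subr0.
have KN : K *m N = 0 by rewrite mulmxBr mulmx1 KP subrr.
have LN : L *m N' = 0 by rewrite mulmxBr mulmx1 LP' subrr.
have scal0 q q' (M : 'M[R]_(q, q')) : (forall i j, K i j *: M = 0) -> M = 0.
  move=> h; apply/matrixP => a b; rewrite mxE; apply: fK => -[i j] /=.
  by have := congr1 (fun M : 'M_(q, q') => M a b) (h i j); rewrite !mxE.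
have scal0' q q' (M : 'M[R]_(q, q')) : (forall i j, L i j *: M = 0) -> M = 0.
  move=> h; apply/matrixP => a b; rewrite mxE; apply: fL => -[i j] /=.
  by have := congr1 (fun M : 'M_(q, q') => M a b) (h i j); rewrite !mxE.
(* It suffices to multiply by the entries of K: K i j P lies in K, G sends K into L, and N' kills
   L. *)
have PGN : P *m G *m N' = 0.
  apply: scal0 => i j.
  have : rle ((K i j)%:M *m P *m G) L.
    apply: rle_trans KG; apply: rle_mulr; apply: Pb => a b.
    by rewrite mxE -mulr_natr mulrC; apply/contentM/content_entry.
  by move=> [Z e]; rewrite -mul_scalar_mx !mulmxA e -mulmxA LN mulmx0.
have PHN : P' *m H *m N = 0.
  apply: scal0' => i j.
  have : rle ((L i j)%:M *m P' *m H) K.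
    apply: rle_trans LH; apply: rle_mulr; apply: P'b => a b.
    by rewrite mxE -mulr_natr mulrC; apply/contentM/content_entry.
  by move=> [Z e]; rewrite -mul_scalar_mx !mulmxA e -mulmxA KN mulmx0.
have GHN : G *m H *m N = N.
  case: GH => Z e; apply/eqP; rewrite -subr_eq0 -[X in _ - X]mul1mx -mulmxBl e.
  by rewrite -mulmxA KN mulmx0.
have HGN : H *m G *m N' = N'.
  case: HG => Z e; apply/eqP; rewrite -subr_eq0 -[X in _ - X]mul1mx -mulmxBl e.
  by rewrite -mulmxA LN mulmx0.
pose X := N *m G *m N'; pose Y := N' *m H *m N.
have XY : X *m Y = N.
  have GNHN : G *m (N' *m (H *m N)) = N.
    by rewrite mulmxBl mul1mx [P' *m _]mulmxA PHN subr0 mulmxA.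
  by rewrite /X /Y -!mulmxA [N' *m (N' *m _)]mulmxA NN' GNHN.
have YX : Y *m X = N'.
  have HNGN : H *m (N *m (G *m N')) = N'.
    by rewrite mulmxBl mul1mx [P *m _]mulmxA PGN subr0 mulmxA.
  by rewrite /X /Y -!mulmxA [N *m (N *m _)]mulmxA NN HNGN.
have aX : \adj X = P' *m \adj G *m P by rewrite /X !adj_mulmx aN aN' mulmxA.
have aY : \adj Y = P *m \adj H *m P' by rewrite /Y !adj_mulmx aN aN' mulmxA.
(* X and Y are inverse isomorphisms between im N and im N'. Their adjugates relate im P and im P',
   and are inverse there because adj(X Y) = adj N = P. *)
pose A := \adj Y + X; pose A' := \adj X + Y.
have AA' : A *m A' = 1%:M.
  have z1 : \adj Y *m Y = 0.
    by rewrite aY /Y !mulmxA -[_ *m P' *m N']mulmxA PN' mulmx0 !mul0mx.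
  have z2 : X *m \adj X = 0.
    by rewrite aX /X !mulmxA -[_ *m N' *m P']mulmxA NP' mulmx0 !mul0mx.
  by rewrite mulmxDl !mulmxDr z1 z2 -adj_mulmx XY aN addr0 add0r addrC subrK.
have A'A : A' *m A = 1%:M.
  have z1 : \adj X *m X = 0.
    by rewrite aX /X !mulmxA -[_ *m P *m N]mulmxA PN mulmx0 !mul0mx.
  have z2 : Y *m \adj Y = 0.
    by rewrite aY /Y !mulmxA -[_ *m N *m P]mulmxA NP mulmx0 !mul0mx.
  by rewrite mulmxDl !mulmxDr z1 z2 -adj_mulmx YX aN' addr0 add0r addrC subrK.
(* [D] is u on im P' and 1 on im N': it cancels the determinant of A and only scales L by a unit. *)
pose u := \det A'; pose D := N' + u *: P'.
have dD : \det D = u by apply: dN'.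
exists (A *m D); split.
- by rewrite det_mulmx dD -det_mulmx AA' det1.
- have -> : K *m (A *m D) = (u *: (K *m \adj H)) *m P'.
    have -> : K *m (A *m D) = K *m \adj H *m P' *m D.
      by rewrite mulmxA [K *m A]mulmxDr aY /X !mulmxA KP KN !mul0mx addr0.
    rewrite mulmxDr -[_ *m P' *m N']mulmxA PN' mulmx0 add0r.
    by rewrite -scalemxAr -scalemxAl -[_ *m P' *m P']mulmxA PP'.
  apply: P'b => i j; rewrite mxE; apply: contentM; apply: cKL; exact: content_mulr.
have LA : rle (L *m A') K.
  have -> : L *m A' = (L *m \adj G) *m P.
    by rewrite mulmxDr aX /Y !mulmxA LP' LN !mul0mx addr0.
  apply: Pb => i j; apply: cLK; exact: content_mulr.
have -> : L = (\det A *: (L *m A')) *m (A *m D).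
  rewrite -scalemxAl !mulmxA -[_ *m A' *m A]mulmxA A'A mulmx1 mulmxDr LN add0r.
  by rewrite -scalemxAr LP' scalerA -det_mulmx AA' det1 scale1r.
by apply: rle_mulr; apply: rleZ.
Qed.

End RankOne.

(** * Gluing along idempotents *)

Lemma idemC (R : comPzRingType) (x : R) : x * x = x -> (1 - x) * (1 - x) = 1 - x.
Proof.
by move=> xx; rewrite mulrBl mul1r mulrBr mulr1 xx subrr subr0.
Qed.

Section MixAt.
Variable R : comPzRingType.

(* The idempotent x splits R as a product: K where x = 1, T where x = 0.       *)
Definition mix (x : R) m t n (K : 'M[R]_(m, n)) (T : 'M[R]_(t, n)) : 'M[R]_(m + t, n) :=
  col_mx (x *: K) ((1 - x) *: T).

Variable x : R.
Hypothesis xx : x * x = x.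

Let xC : x * (1 - x) = 0. Proof. by rewrite mulrBr mulr1 xx subrr. Qed.
Let Cx : (1 - x) * x = 0. Proof. by rewrite mulrC xC. Qed.
Let CC : (1 - x) * (1 - x) = 1 - x.
Proof. by rewrite mulrBr mulr1 Cx subr0. Qed.

Lemma rle_mix m t q n (B : 'M[R]_(q, n)) (K : 'M[R]_(m, n)) (T : 'M[R]_(t, n)) :
  rle B (mix x K T) -> rle (x *: B) (x *: K).
Proof.
move=> [Z ->]; exists (lsubmx Z).
rewrite -[Z in LHS]hsubmxK mul_row_col scalerDr -!scalemxAr !scalerA xx xC.
by rewrite scale0r addr0.
Qed.

Lemma miso_mix m p t n (K : 'M[R]_(m, n)) (L : 'M[R]_(p, n)) (T : 'M[R]_(t, n)) :
  miso K L -> miso (mix x K T) (mix x L T).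
Proof.
pose S (G : 'M[R]_n) := x *: G + (1 - x) *: 1%:M.
have half q r (A : 'M[R]_(q, n)) (B : 'M[R]_(r, n)) G : rle (A *m G) B ->
    rle (mix x A T *m S G) (mix x B T).
  move=> [Z e]; rewrite mul_col_mx; apply: rle_col.
    apply: rle_usub; exists Z; rewrite mulmxDr -!scalemxAl -!scalemxAr !scalerA.
    by rewrite xx xC scale0r addr0 e.
  apply: rle_dsub; exists 1%:M; rewrite mul1mx mulmxDr -!scalemxAl -!scalemxAr !scalerA.
  by rewrite Cx CC scale0r add0r mulmx1.
have one G H r (B : 'M[R]_(r, n)) : rle (G *m H - 1%:M) B ->
    rle (S G *m S H - 1%:M) (mix x B T).
  move=> [Z e]; apply: rle_usub; exists Z; rewrite -scalemxAr -e.
  rewrite mulmxDl !mulmxDr -!scalemxAl -!scalemxAr !scalerA xx xC Cx CC !scale0r mulmx1.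
  rewrite addr0 add0r scalerBr scalerBl scale1r.
  by rewrite -addrA; congr (_ + _); rewrite addrAC subrr add0r.
move=> [G [H [h1 h2 h3 h4]]]; exists (S G), (S H).
by split; [exact: half|exact: half|exact: one|exact: one].
Qed.

Lemma det_idempotent n (A B : 'M[R]_n) : x *: A = x *: B -> x * \det A = x * \det B.
Proof.
move=> e; apply/eqP; rewrite -subr_eq0 -mulrBr; apply/eqP.
apply: (det_cong (Q := fun y => x * y = 0)) => [|y z hy hz|a y hy|i j].
- by rewrite mulr0.
- by rewrite mulrDr hy hz addr0.
- by rewrite mulrCA hy mulr0.
have := congr1 (fun M : 'M_n => M i j) e; rewrite !mxE => h.
by rewrite mulrBr h subrr.
Qed.

End MixAt.

Section Gluing.
Variable R : comPzRingType.

(** The matrix x A + (1 - x) B agrees with A and with B on the two factors of R, hence has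
    determinant 1. The fillers [T] and [T'] are free, so that a property such as faithfulness can be
    made to hold on all of R. *)
Lemma sl_equiv_mix (x : R) m p t t' n (K : 'M[R]_(m, n)) (L : 'M[R]_(p, n))
    (T : 'M[R]_(t, n)) (T' : 'M[R]_(t', n)) : x * x = x ->
  sl_equiv (mix x K T) (mix x L T) -> sl_equiv (mix (1 - x) K T') (mix (1 - x) L T') ->
  sl_equiv K L.
Proof.
move=> xx [A [dA KA LA]] [B [dB KB LB]].
have xC : x * (1 - x) = 0 by rewrite mulrBr mulr1 xx subrr.
have CC : (1 - x) * (1 - x) = 1 - x by rewrite mulrBl xC subr0 mul1r.
pose D := x *: A + (1 - x) *: B.
have xD : x *: D = x *: A by rewrite scalerDr !scalerA xx xC scale0r addr0.
have CD : (1 - x) *: D = (1 - x) *: B.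
  by rewrite scalerDr !scalerA [(1 - x) * x]mulrC CC xC scale0r add0r.
have mixM y q r (M : 'M[R]_(q, n)) (U : 'M[R]_(r, n)) (C : 'M[R]_n) :
    mix y M U *m C = mix y (M *m C) (U *m C).
  by rewrite mul_col_mx -!scalemxAl.
have mixl y q r (M : 'M[R]_(q, n)) (U : 'M[R]_(r, n)) :
    rle (y *: M) (mix y M U) by apply: rle_usub; apply: rle_refl.
have piece y q r t1 t2 (M : 'M[R]_(q, n)) (N : 'M[R]_(r, n)) (U : 'M[R]_(t1, n))
    (V : 'M[R]_(t2, n)) : y * y = y -> rle (mix y M U) (mix y N V) -> rle (y *: M) (y *: N).
  move=> yy h; have := rle_mix yy (rle_trans (mixl y _ _ M U) h).
  by rewrite scalerA yy.
have dD : \det D = 1.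
  have e1 := det_idempotent xD; have e2 := det_idempotent CD.
  have : x * \det D + (1 - x) * \det D = x * 1 + (1 - x) * 1 by rewrite e1 e2 dA dB.
  by rewrite -!mulrDl addrC subrK !mul1r.
have half q (y : 'M[R]_(q, n)) : x *: y + (1 - x) *: y = y.
  by rewrite -scalerDl addrC subrK scale1r.
have xS q (M : 'M[R]_(q, n)) : rle (x *: M) M by apply: rleZ; apply: rle_refl.
have cS q (M : 'M[R]_(q, n)) : rle ((1 - x) *: M) M by apply: rleZ; apply: rle_refl.
rewrite !mixM in KA LA KB LB.
exists D; split=> //.
- rewrite -[K *m D]half; apply: rleD.
    rewrite scalemxAr xD -scalemxAr; apply: rle_trans (xS _ L).
    exact: (piece _ _ _ _ _ _ _ _ _ xx KA).
  rewrite scalemxAr CD -scalemxAr; apply: rle_trans (cS _ L).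
  exact: (piece _ _ _ _ _ _ _ _ _ CC KB).
- rewrite -[L]half; apply: rleD.
    apply: rle_trans (xS _ _); rewrite [x *: (K *m D)]scalemxAr xD -scalemxAr.
    exact: (piece _ _ _ _ _ _ _ _ _ xx LA).
  apply: rle_trans (cS _ _); rewrite [(1 - x) *: (K *m D)]scalemxAr CD -scalemxAr.
  exact: (piece _ _ _ _ _ _ _ _ _ CC LB).
Qed.

End Gluing.

(** * Induction on the number of generators *)

Section Prufer.
Variable R : comNzRingType.
Hypothesis pp : forall a : R,
  exists e, e * e = e /\ forall x, a * x = 0 <-> e * x = x.
Hypothesis arith : forall a b : R,
  exists t c d, t * b = c * a /\ (1 - t) * a = d * b.
Hypothesis stable : almost_stable R.
Hypothesis red : reduced R.

Lemma sl_equiv_row0 m p (K : 'M[R]_(m, 0)) (L : 'M[R]_(p, 0)) : sl_equiv K L.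
Proof. by exists 1%:M; rewrite det1; split=> //; exists 0; apply/matrixP => ? []. Qed.

Lemma rank_le1_scale m n (K : 'M[R]_(m, n)) x : rank_le1 K -> rank_le1 (x *: K).
Proof.
move=> K1 i i' j j'; rewrite !mxE.
have -> (y z : R) : x * y * (x * z) = x * x * (y * z) by ring.
by rewrite K1; ring.
Qed.

Lemma rank_le1_mix m n (K : 'M[R]_(m, n)) (T : 'rV[R]_n) x : x * x = x ->
  rank_le1 (x *: K) -> rank_le1 (mix x K T).
Proof.
move=> xx K1; have xC y z : x * y * ((1 - x) * z) = 0.
  have -> : x * y * ((1 - x) * z) = (x - x * x) * (y * z) by ring.
  by rewrite xx subrr mul0r.
move=> i i' j j'; case: (split_ordP i) => k ->; case: (split_ordP i') => k' ->;
  rewrite ?col_mxEu ?col_mxEd; first exact: K1.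
- by rewrite !mxE !xC.
- by rewrite !mxE [LHS]mulrC [RHS]mulrC !xC.
by rewrite !ord1 mulrC.
Qed.

(** Where the support idempotent h of K is 0, K vanishes, and so does L by equality of contents.
    Where h is 1, [rank1_sl_equiv] applies; the filler e_1, available for positive n, keeps the
    matrix faithful of rank at most 1. *)
Lemma rank_le1_sl_equiv m p n (K : 'M[R]_(m, n)) (L : 'M[R]_(p, n)) :
  miso K L -> rank_le1 K -> sl_equiv K L.
Proof.
case: n K L => [|n] K L KL K1; first exact: sl_equiv_row0.
have [h [hh hK Kh]] := support_idempotent pp (fun p : 'I_m * 'I_n.+1 => K p.1 p.2).
have hC : h * (1 - h) = 0 by rewrite mulrBr mulr1 hh subrr.
apply: (sl_equiv_mix (T := delta_mx 0 0 : 'rV_n.+1) (T' := 0 : 'rV_n.+1) hh).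
  apply: (rank1_sl_equiv pp arith); [exact: miso_mix|exact: red| |].
    by apply: rank_le1_mix => //; apply: rank_le1_scale.
  move=> x Kx; have hx : h * x = 0.
    apply: Kh => -[i j] /=; have := Kx (lshift 1 i, j) => /=.
    by rewrite col_mxEu mxE (hK (i, j)).
  have := Kx (rshift m 0, 0) => /=; rewrite col_mxEd !mxE !eqxx mulr1 => e.
  by have : (1 - h) * x + h * x = 0; [rewrite e hx addr0|rewrite -mulrDl subrK mul1r].
have CK : (1 - h) *: K = 0.
  by apply/matrixP => i j; rewrite !mxE mulrBl mul1r (hK (i, j)) subrr.
have CL : (1 - h) *: L = 0.
  apply/matrixP => i j; rewrite !mxE.
  have := content_miso (miso_sym KL) (content_entry L i j).
  apply: (contentE (Q := fun y => (1 - h) * y = 0)) => [|y z hy hz|a y hy|k l].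
  - by rewrite mulr0.
  - by rewrite mulrDr hy hz addr0.
  - by rewrite mulrCA hy mulr0.
  by have := congr1 (fun M : 'M_(m, n.+1) => M k l) CK; rewrite !mxE.
apply: sl_equiv_same_rows.
by rewrite /mix CK CL !scaler0; split; rewrite col_mx0; apply: rle0.
Qed.

Lemma faithful_minor2_mix m k (K : 'M[R]_(m, k.+2)) f : f * f = f ->
  (forall x, (forall i, minor2 K i * x = 0) -> f * x = 0) ->
  faithful (minor2 (mix f K 1%:M)).
Proof.
move=> ff fK x h.
have fx : f * x = 0.
  rewrite -ff -mulrA; apply: fK => -[[i i'] [j j']].
  have := h ((lshift k.+2 i, lshift k.+2 i'), (j, j')).
  rewrite /minor2 /= !col_mxEu !mxE => <-.
  by rewrite -{1}ff; ring.
have Cff := idemC ff.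
have := h ((rshift m 0, rshift m 1), (0, 1)).
rewrite /minor2 /= !col_mxEd !mxE /= !mulr1n !mulr0n !mulr1 !mulr0 subr0 Cff.
by rewrite mulrBl mul1r fx subr0.
Qed.

Lemma rank_le1_mix_support m n (K : 'M[R]_(m, n)) f : f * f = f ->
  (forall i, f * minor2 K i = minor2 K i) -> rank_le1 (mix (1 - f) K (0 : 'rV_n)).
Proof.
move=> ff fK; have Cff := idemC ff.
apply: rank_le1_mix => // i i' j j'; rewrite !mxE.
apply/eqP; rewrite -subr_eq0; apply/eqP.
transitivity ((1 - f) * ((1 - f) * minor2 K ((i, i'), (j, j')))).
  by rewrite /minor2 /=; ring.
by rewrite [(1 - f) * minor2 _ _]mulrBl mul1r fK subrr mulr0.
Qed.

Theorem prufer_sl_cancel : sl_cancel_ring R.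
Proof.
elim=> [|n IH] m p K L KL; first exact: sl_equiv_row0.
case: n IH K L KL => [|k] IH K L KL.
  by apply: rank_le1_sl_equiv => // i i' j j'; rewrite !ord1.
have [f [ff fK Kf]] := support_idempotent pp (minor2 K).
have Cff := idemC ff.
(* The identity filler has a 2x2 minor equal to 1, which makes the minors faithful on all of R; the
   zero filler keeps rank at most 1. *)
apply: (sl_equiv_mix (T := 1%:M : 'M_k.+2) (T' := 0 : 'rV_k.+2) ff); last first.
  apply: rank_le1_sl_equiv; first exact: miso_mix.
  exact: rank_le1_mix_support.
(* Where the support g of the minors of L is 0, L has rank at most 1, hence so has K by
   [rank_le1_miso]; thus f (1 - g) = 0. *)
have Lf x : (forall i, minor2 L i * x = 0) -> f * x = 0.
  have [g [gg gL Lg]] := support_idempotent pp (minor2 L).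
  have Cgg := idemC gg.
  have K1 := rank_le1_miso pp red (miso_mix Cgg (0 : 'rV_k.+2) (miso_sym KL))
    (rank_le1_mix_support gg gL).
  have fg : f * (1 - g) = 0.
    apply: Kf => -[[i i'] [j j']]; have := K1 (lshift 1 i) (lshift 1 i') j j'.
    rewrite !col_mxEu !mxE => /eqP; rewrite -subr_eq0 => /eqP e.
    by rewrite -Cgg -[RHS]e /minor2 /=; ring.
  by move=> /Lg gx; move/(congr1 ( *%R^~ x)): fg; rewrite -mulrA mulrBl gx subr0 mul1r mul0r.
have {Kf}fK' := faithful_minor2_mix ff Kf; have fL' := faithful_minor2_mix ff Lf.
have {KL} := miso_mix ff (1%:M : 'M_k.+2) KL.
move: (mix f K _) (mix f L _) fK' fL' => {fK Lf}K' L' fK fL KL.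
have [K1 eK] := split_unimodular pp arith stable (k := k) fK.
have [L1 eL] := split_unimodular pp arith stable (k := k) fL.
(* K' and L' have the same content, so both splittings can share the summand R/I, which cancels
   since I contains a regular element. *)
have ab : same_rows (block_mx (mxvec L')^T 0 0 L1) (block_mx (mxvec K')^T 0 0 L1).
  split; apply/rle_block; split; try exact: rle0; try exact: rle_refl.
    by apply: rle_content => i; apply: (content_miso (miso_sym KL)); apply: content_mxvec.
  by apply: rle_content => i; apply: (content_miso KL); apply: content_mxvec.
apply: (sl_equiv_trans eK); apply: sl_equiv_sym; apply: (sl_equiv_trans eL).
apply: (sl_equiv_trans (sl_equiv_same_rows ab)).
apply: sl_equiv_sym; apply: block_sl_equiv; apply: IH.
have [ep [_ rs]] := faithful_regular pp (faithful_minor2 fK).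
apply: (miso_cancel stable rs (al := (mxvec K')^T)).
  apply: rle_content => i; rewrite ord1 mxE eqxx mulr1n.
  by apply: content_sum => j _; apply/contentM/content_entry.
apply: miso_trans (sl_equiv_miso (sl_equiv_same_rows ab)).
apply: miso_trans (sl_equiv_miso eL); apply: miso_trans KL.
exact: miso_sym (sl_equiv_miso eK).
Qed.

End Prufer.

(** * Coherent Pruefer rings *)

Section Arithmetic.
Variable R : comPzRingType.

Lemma prime_ideal_over (Q : R -> Prop) :
  Q 0 -> (forall x y, Q x -> Q y -> Q (x + y)) -> (forall a x, Q x -> Q (a * x)) ->
  ~ Q 1 -> exists P : prime_ideal R, forall x, Q x -> x \in prime_mem P.
Proof.
move=> Q0 QD QM Q1.
pose good (A : R -> Prop) := [/\ forall x y, A x -> A y -> A (x + y),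
  forall a x, A x -> A (a * x), ~ A 1 & forall x, A x -> forall y, Q y -> A y].
have [F FP Ftot|A [[AD AM A1 AQ] Amax]] := @classical_sets.Zorn_bigcup R good.
  split.
  - move=> x y [A FA Ax] [B FB By].
    case: (Ftot A B FA FB) => AB.
      by exists B => //; case: (FP B FB) => BD _ _ _; apply: BD => //; apply: AB.
    by exists A => //; case: (FP A FA) => AD _ _ _; apply: AD => //; apply: AB.
  - by move=> a x [A FA Ax]; exists A => //; case: (FP A FA) => _ AM _ _; apply: AM.
  - by move=> [A FA A1]; case: (FP A FA).
  - by move=> x [A FA Ax] y Qy; exists A => //; case: (FP A FA) => _ _ _ /(_ x Ax y); apply.
have QA x : Q x -> A x.
  move=> Qx; case: (pselect (exists y, A y)) => [[y Ay]|nA]; first exact: (AQ y).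
  case: (Amax Q); last by split.
  split=> [y Ay|QA]; first by case: nA; exists y.
  by apply: nA; exists 0; apply: QA.
have A0 : A 0 by apply: QA.
have [P0 PD PM P1] : [/\ 0 \in [pred x | `[< A x >]],
    forall x y, x \in [pred x | `[< A x >]] -> y \in [pred x | `[< A x >]] ->
      x + y \in [pred x | `[< A x >]],
    forall a x, x \in [pred x | `[< A x >]] -> a * x \in [pred x | `[< A x >]]
  & 1 \notin [pred x | `[< A x >]]].
  split; rewrite ?inE; first exact/asboolP.
  - by move=> x y; rewrite !inE => /asboolP Ax /asboolP Ay; apply/asboolP/AD.
  - by move=> a x; rewrite !inE => /asboolP Ax; apply/asboolP/AM.
  - by apply/negP => /asboolP.
have PP x y : x * y \in [pred x | `[< A x >]] ->
    x \in [pred x | `[< A x >]] \/ y \in [pred x | `[< A x >]].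
  rewrite !inE => /asboolP Axy.
  case: (pselect (A x)) => [Ax|nAx]; [by left; apply/asboolP|right; apply/asboolP].
  apply: contrapT => nAy.
  pose B z := exists a r, A a /\ z = a + r * x.
  have B1 : ~ B 1.
    move=> [a [r [Aa e]]]; apply: nAy; rewrite -[y]mul1r e.
    have -> : (a + r * x) * y = y * a + r * (x * y) by ring.
    by apply: AD; apply: AM.
  case: (Amax B).
    split=> [z Az|BA]; first by exists z, 0; rewrite mul0r addr0.
    by apply: nAx; apply: BA; exists 0, 1; rewrite add0r mul1r.
  split=> //.
  - move=> z t [a [r [Aa ->]]] [b [r' [Ab ->]]]; exists (a + b), (r + r').
    by split; [apply: AD|ring].
  - move=> z t [a [r [Aa ->]]]; exists (z * a), (z * r).
    by split; [apply: AM|ring].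
  - by move=> _ _ z /QA Az; exists z, 0; rewrite mul0r addr0.
exists (PrimeIdeal P0 PD PM P1 PP) => x /QA Ax.
by rewrite inE; apply/asboolP.
Qed.

(** Otherwise a prime P contains the ideal [Q] = (a : b) + (b : a). At P, (a, b) is generated by
    some i = ga a + de b, with si a = a' i and si b = b' i for some si outside P. Membership in [Q]
    forces a' and b' into P, then si as well, by a Nakayama argument. *)
Lemma arithmetic_comaximal : arithmetic R -> forall a b : R,
  exists t c d, t * b = c * a /\ (1 - t) * a = d * b.
Proof.
move=> hR a b.
pose Q z := exists t t', [/\ z = t + t', exists c, t * b = c * a & exists d, t' * a = d * b].
case: (pselect (Q 1)) => [[t [t' [e [c tc] [d td]]]]|nQ1].
  by exists t, c, d; split=> //; rewrite e [t + t']addrC addrK.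
exfalso; have [||x y|P QP] := prime_ideal_over _ _ _ nQ1.
- by exists 0, 0; rewrite addr0; split=> //; exists 0; rewrite !mul0r.
- move=> x y [t [t' [-> [c tc] [d td]]]] [u [u' [-> [c' tc'] [d' td']]]].
  exists (t + u), (t' + u'); split; first by ring.
    by exists (c + c'); rewrite !mulrDl tc tc'.
  by exists (d + d'); rewrite !mulrDl td td'.
- move=> [t [t' [-> [c tc] [d td]]]]; exists (x * t), (x * t'); split; first by ring.
    by exists (x * c); rewrite -!mulrA tc.
  by exists (x * d); rewrite -!mulrA td.
have Q1 t c : t * b = c * a -> t \in prime_mem P.
  by move=> e; apply: QP; exists t, 0; rewrite addr0; split=> //;
    [exists c|exists 0; rewrite !mul0r].
have Q2 t c : t * a = c * b -> t \in prime_mem P.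
  by move=> e; apply: QP; exists 0, t; rewrite add0r; split=> //;
    [exists 0; rewrite !mul0r|exists c].
pose v : {ffun 'I_2 -> R^o} := [ffun i => if i == 0 then a else b].
pose I : R^o -> Prop := fun x => Defs.span v x.
have vE x : I x <-> exists c d, x = c * a + d * b.
  split=> [[c ->]|[c [d ->]]].
    exists (c 0), (c 1); rewrite !big_ord_recl big_ord0 addr0 !ffunE /=.
    by congr (_ + c _ *: _); apply: val_inj.
  exists [ffun i => if i == 0 then c else d].
  by rewrite !big_ord_recl big_ord0 addr0 !ffunE.
have [|g gP] := hR I _ P; first by exists 2%N, v.
have Ia : I a by apply/vE; exists 1, 0; ring.
have Ib : I b by apply/vE; exists 0, 1; ring.
set S := GRing.MulClosed.clone R (prime_compl P) _ in g gP *.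
have Sin s : (s \in S) = (s \notin prime_mem P) by [].
have [i [s [/vE[ga [de iE]] gE]]] : @extended_ideal R S I g by apply/gP; exists 1; rewrite mul1r.
have frac (x : R) : I x -> exists s, s \in S /\ exists y, s * x = y * i.
  move=> Ix; have [|c] := (gP (@loc_frac R S x (den1 S))).1.
    by exists x, (den1 S).
  elim/quotW: c => -[c t]; rewrite gE /loc_frac -[_ * _]/(loc_mul _ _) -pi_loc_mul => /frac_eqP[u uS /= e].
  exists (u * (sval t * sval s)); split.
    by rewrite !rpredM //; [apply: (valP t)|apply: (valP s)].
  by exists (u * c); move: e; rewrite mulr1 => e; rewrite -mulrA [_ * x]mulrC e mulrA.
have [s1 [s1S [a1 e1]]] := frac _ Ia; have [s2 [s2S [b1 e2]]] := frac _ Ib.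
have ss : s1 * s2 \in S by rewrite rpredM.
pose a' := s2 * a1; pose b' := s1 * b1; pose si := s1 * s2.
have ea : si * a = a' * i by rewrite /si /a' mulrAC e1; ring.
have eb : si * b = b' * i by rewrite /si /b' -mulrA e2; ring.
have aP : a' \in prime_mem P.
  have : a' * si \in prime_mem P.
    by apply: (Q1 _ (b' * si)); rewrite -[LHS]mulrA -[RHS]mulrA ea eb; ring.
  by move/prime_idealP => [] //; move: ss; rewrite Sin => /negP.
have bP : b' \in prime_mem P.
  have : b' * si \in prime_mem P.
    by apply: (Q2 _ (a' * si)); rewrite -[LHS]mulrA -[RHS]mulrA ea eb; ring.
  by move/prime_idealP => [] //; move: ss; rewrite Sin => /negP.
pose ta := si - (ga * a' + de * b').
have tai : ta * i = 0.
  rewrite /ta mulrBl {1}iE.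
  have -> : si * (ga * a + de * b) = ga * (si * a) + de * (si * b) by ring.
  by rewrite ea eb; ring.
have : ta * si \in prime_mem P.
  by apply: (Q2 _ 0); rewrite -[LHS]mulrA ea mulrCA tai; ring.
have nsi : si \notin prime_mem P by rewrite -Sin.
move/prime_idealP => []; last by move: nsi => /negP.
move=> taP; move/negP: nsi; apply.
have -> : si = ta + (ga * a' + de * b') by rewrite /ta subrK.
by apply: prime_idealD => //; apply: prime_idealD; apply: prime_idealM.
Qed.

Lemma coherent_annihilator : coherent R -> forall a : R,
  exists k (b : 'I_k -> R), (forall i, a * b i = 0) /\
    forall x, a * x = 0 -> exists c : 'I_k -> R, x = \sum_i c i * b i.
Proof.
move=> hR a; pose v : {ffun 'I_1 -> R^o} := [ffun=> a].
have [||k [K KE]] := @fg_relations R R^o (fun x => Defs.span v x) 1 v.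
- by apply: hR; exists 1%N, v.
- by [].
have lE (x : 'rV[R]_1) : lin_comb v x = a * x 0 0.
  by rewrite /lin_comb big_ord1 ffunE mulrC.
exists k, (fun i => K i 0); split=> [i|x ax].
  have := (KE (row i K)).2; rewrite lE mxE; apply.
  by rewrite rowE; apply: rle_mul.
have [|c e] := (KE x%:M).1; first by rewrite lE mxE eqxx mulr1n.
exists (c 0); have := congr1 (fun M : 'M_1 => M 0 0) e.
by rewrite !mxE eqxx mulr1n.
Qed.

(** For each of finitely many generators b of Ann(a), [arith] gives t such that t b and (1 - t) a
    square to 0. The product T of these t kills Ann(a) and fixes a, so the idempotent is 1 - T. *)
Lemma principal_annihilator : reduced R -> coherent R ->
  (forall a b : R, exists t c d, t * b = c * a /\ (1 - t) * a = d * b) ->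
  forall a : R, exists e, e * e = e /\ forall x, a * x = 0 <-> e * x = x.
Proof.
move=> red coh arith a.
have [k [b [ab bg]]] := coherent_annihilator coh a.
have sq0 (x : R) : x * x = 0 -> x = 0 by move=> xx; apply: (@red _ 2); rewrite expr2.
have /fin_all_exists[t tP] : forall i, exists t, t * b i = 0 /\ t * a = a.
  move=> i; have [t [c [d [e1 e2]]]] := arith a (b i); exists t; split.
    apply: sq0; have -> : t * b i * (t * b i) = t * b i * b i * t by ring.
    rewrite e1; have -> : c * a * b i * t = c * t * (a * b i) by ring.
    by rewrite ab mulr0.
  suff /eqP : (1 - t) * a = 0 by rewrite mulrBl mul1r subr_eq0 => /eqP.
  apply: sq0; have -> : (1 - t) * a * ((1 - t) * a) = (1 - t) * a * a * (1 - t) by ring.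
  rewrite e2; have -> : d * b i * a * (1 - t) = d * (1 - t) * (a * b i) by ring.
  by rewrite ab mulr0.
pose T := \prod_i t i.
have Tb i : T * b i = 0.
  by rewrite /T (bigD1 i) //= mulrAC; case: (tP i) => -> _; rewrite mul0r.
have Ta : T * a = a.
  rewrite /T; elim/big_rec: _ => [|i x _ e]; first by rewrite mul1r.
  by rewrite -mulrA e; case: (tP i).
have Tx x : a * x = 0 -> T * x = 0.
  by move=> /bg[c ->]; rewrite mulr_sumr big1 // => i _; rewrite mulrCA Tb mulr0.
have aT : a * (1 - T) = 0 by rewrite mulrBr mulr1 mulrC Ta subrr.
exists (1 - T); split; first by rewrite mulrBl mul1r Tx // subr0.
move=> x; split=> [/Tx h|<-]; first by rewrite mulrBl mul1r h subr0.
by rewrite mulrA aT mul0r.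
Qed.

End Arithmetic.

(** * Almost local-global rings *)

Lemma principal_quotient (R : comNzRingType) (s : R) : ~ (exists a, 1 = a * s) ->
  exists (T : comNzRingType) (pi : {rmorphism R -> T}),
    (forall y, exists x, pi x = y) /\ (forall x, pi x = 0 <-> exists a, x = a * s).
Proof.
move=> s1; pose I : {pred R} := fun x => `[< exists a, x = a * s >].
have Icl : idealr_closed I.
  split; rewrite ?unfold_in.
  - by apply/asboolP; exists 0; rewrite mul0r.
  - exact/asboolP.
  - move=> a x y; rewrite !unfold_in => /asboolP[b ->] /asboolP[c ->].
    by apply/asboolP; exists (a * b + c); ring.
pose J : idealr R := HB.pack (I : R -> bool) (isIdealr.Build R I Icl).
exists {ideal_quot J}, \pi; split=> [y|x].
  by exists (repr y); apply: reprK.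
rewrite -(rmorph0 (\pi_{ideal_quot J})); split=> [/eqP|[a ->]].
  by rewrite -Quotient.idealrBE subr0 unfold_in => /asboolP.
apply/eqP; rewrite -Quotient.idealrBE subr0 unfold_in.
by apply/asboolP; exists a.
Qed.

Lemma split_lshift m n (i : 'I_m) : split (lshift n i) = inl i.
Proof. exact: (unsplitK (inl i)). Qed.

Lemma split_rshift m n (i : 'I_n) : split (rshift m i) = inr i.
Proof. exact: (unsplitK (inr i)). Qed.

(** The polynomial sum_i X_i (y_i + sum_j Z_j B_ji) takes the values y_i and y_i + B_ji, which
    generate the unit ideal modulo s; the Z-part of a point with unit value is t. A unit s is
    treated apart, since R/Rs is then zero. *)
Lemma almost_local_global_stable (R : comNzRingType) :
  almost_local_global R -> almost_stable R.
Proof.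
move=> hR s rs k n y B r hc.
case: (pselect (exists a, 1 = a * s)) => [[a e]|nu].
  by exists 0, a; rewrite -e subrr; apply: content0.
have [T [pi [pis piK]]] := principal_quotient nu.
have ls : GRing.lreg s.
  move=> x z e; apply/eqP; rewrite -subr_eq0; apply/eqP/rs.
  by rewrite mulrBr e subrr.
have LG := hR s ls T pi pis piK.
pose p : {mpoly T[n + k]} :=
  \sum_(i < n) 'X_(lshift k i) * ((pi (y 0 i))%:MP + \sum_(j < k) 'X_(rshift n j) * (pi (B j i))%:MP).
have pE x : p.@[x] =
    \sum_(i < n) x (lshift k i) * (pi (y 0 i) + \sum_(j < k) x (rshift n j) * pi (B j i)).
  rewrite raddf_sum; apply: eq_bigr => i _.
  rewrite /= mevalM mevalXU mevalD mevalC raddf_sum; congr (_ * (_ + _)).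
  by apply: eq_bigr => j _; rewrite /= mevalM mevalXU mevalC.
pose Q z := exists (l : nat) (c : 'I_l -> T) (x : 'I_l -> 'I_(n + k) -> T),
  \sum_j c j * p.@[x j] = pi z.
have Q0 : Q 0.
  by exists 0%N, (fun=> 0), (fun _ _ => 0); rewrite big_ord0 rmorph0.
have QD z t : Q z -> Q t -> Q (z + t).
  move=> [l [c [x e]]] [l' [c' [x' e']]].
  exists (l + l')%N, (fun j => match split j with inl i => c i | inr i => c' i end),
    (fun j => match split j with inl i => x i | inr i => x' i end).
  rewrite big_split_ord rmorphD -e -e'; congr (_ + _); apply: eq_bigr => i _.
    by rewrite /= split_lshift.
  by rewrite /= split_rshift.
have QM a z : Q z -> Q (a * z).
  move=> [l [c [x e]]]; exists l, (fun j => pi a * c j), x.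
  by rewrite rmorphM -e mulr_sumr; apply: eq_bigr => j _; rewrite mulrA.
have Qp z x : p.@[x] = pi z -> Q z.
  by move=> e; exists 1%N, (fun=> 1), (fun=> x); rewrite big_ord1 mul1r.
pose ev i (t : 'I_k -> T) (l : 'I_(n + k)) : T :=
  match split l with inl i' => (i' == i)%:R | inr j => t j end.
have evE i t : p.@[ev i t] = pi (y 0 i) + \sum_(j < k) t j * pi (B j i).
  rewrite pE (bigD1 i) //= [X in _ + X]big1 => [|i' ii']; last first.
    by rewrite /ev split_lshift (negPf ii') mul0r.
  rewrite /ev split_lshift eqxx mul1r addr0; congr (_ + _).
  by apply: eq_bigr => j _; rewrite split_rshift.
have Qy i : Q (y 0 i).
  by apply: (Qp _ (ev i (fun=> 0))); rewrite evE big1 ?addr0 // => j _; rewrite mul0r.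
have QB j i : Q (B j i).
  have -> : B j i = (y 0 i + B j i) + (- 1) * y 0 i by ring.
  apply: QD; last exact: QM.
  apply: (Qp _ (ev i (fun j' => (j' == j)%:R))); rewrite evE rmorphD; congr (_ + _).
  rewrite (bigD1 j) //= eqxx mul1r big1 ?addr0 // => j' jj'.
  by rewrite (negPf jj') mul0r.
have pis0 a : pi (a * s) = 0 by apply/piK; exists a.
have [l [c [x e]]] : Q (1 - r * s).
  move: hc; apply: contentE => // i j; case: (split_ordP i) => i' ->.
    by rewrite col_mxEu ord1.
  by rewrite col_mxEd.
have [|z [v pz]] := LG _ p.
  by exists l, c, x; rewrite e rmorphB rmorph1 pis0 subr0.
have [zR zE] : exists zR : 'I_(n + k) -> R, forall i, pi (zR i) = z i.
  exact: (fin_all_exists (fun i => pis (z i))).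
have [vR vE] := pis v.
pose t : 'rV[R]_k := \row_j zR (rshift n j).
pose w := \sum_(i < n) zR (lshift k i) * (y + t *m B) 0 i * vR.
have [r' r'E] : exists r', 1 - w = r' * s.
  apply/piK; rewrite rmorphB rmorph1 -pz pE mulr_suml rmorph_sum -sumrB big1 // => i _.
  rewrite !rmorphM zE vE !mxE rmorphD rmorph_sum; apply/eqP; rewrite subr_eq0.
  apply/eqP; congr (_ * (_ + _) * _); apply: eq_bigr => j _.
  by rewrite rmorphM mxE zE.
exists t, r'; rewrite -r'E; have -> : 1 - (1 - w) = w by ring.
apply: content_sum => i _.
by rewrite mulrC; apply/contentM/contentM/content_entry.
Qed.

Lemma sl_cancel_trivial (R : comPzRingType) : (1 : R) = 0 -> sl_cancel_ring R.
Proof.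
move=> R0 n m p K L _.
have eq0 q q' (A : 'M[R]_(q, q')) : A = 0.
  by apply/matrixP => i j; rewrite mxE -[A i j]mul1r R0 mul0r.
exists 1%:M; rewrite det1; split=> //.
  by rewrite [_ *m _]eq0; apply: rle0.
by rewrite [L]eq0; apply: rle0.
Qed.

Theorem corollary1p4 (R : comPzRingType)
    (hR : elementary_divisor_ring R \/
          (almost_local_global R /\ coherent R /\ prufer R))
    (M : lmodType R) (hM : finitely_presented M)
    (m : nat) (hm : is_min_generators M m)
    (n : nat) (hn : (m <= n)%N) :
  aut_sl_transitive M n.
Proof.
apply: sl_cancel_transitive hM.
case: hR => [|[alg [coh [red ari]]]]; first exact: edr_sl_cancel.
have [R0|R1] := eqVneq (1 : R) 0; first exact: sl_cancel_trivial.
have arith := arithmetic_comaximal ari.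
have pp := principal_annihilator red coh arith.
pose S : comNzRingType :=
  HB.pack (GRing.ComPzRing.sort R) (GRing.PzSemiRing_isNonZero.Build R R1).
have stable : almost_stable S by apply: almost_local_global_stable.
exact: (@prufer_sl_cancel S pp arith stable red).
Qed.
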